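(* Let $T$ be a rooted chain complete tree, endowed with the coarse wedge topology. Let $R=\{t\in T:\operatorname{cf}(t)=\omega_1 \text{ and } \operatorname{ims}(t)\neq\emptyset\}$. Consider the following conditions: (i) $|\operatorname{ims}(t)|<\omega_0$ (i.e. $\operatorname{ims}(t)$ is finite) for every $t\in R$; (ii) $R\cap \operatorname{Lev}_{\alpha}(T)$ is $\omega_1$-relatively discrete (in $T$) for each ordinal $\alpha<\omega_2$ with $\operatorname{cf}(\alpha)=\omega_1$. Then the following two statements hold: (1) If $T$ is Valdivia, then $\operatorname{ht}(T)\leq\omega_2$ and (i), (ii) hold. (2) If $\operatorname{ht}(T)<\omega_2$ and (i), (ii) hold, then $T$ is Valdivia.
   Context: A tree is a partially ordered set $(T,<)$ such that for every $t\in T$ the set $\{s\in T:s<t\}$ is well-ordered by $<$. It is rooted if it has exactly one minimal element, and chain complete if every chain (totally ordered subset) has a supremum. For $t\in T$, $\operatorname{ht}(t,T)$ is the order type of $\{s\in T:s<t\}$; $\operatorname{Lev}_\alpha(T)=\{t\in T:\operatorname{ht}(t,T)=\alpha\}$; $\operatorname{ht}(T)$ is the least $\alpha$ with $\operatorname{Lev}_\alpha(T)=\emptyset$; $\operatorname{cf}(t)$ is the cofinality of $\operatorname{ht}(t,T)$, with $\operatorname{cf}(t)=0$ if $\operatorname{ht}(t,T)$ is a successor ordinal; $\operatorname{ims}(t)=\{s\in T:t<s,\ \operatorname{ht}(s,T)=\operatorname{ht}(t,T)+1\}$ is the set of immediate successors of $t$; $V_t=\{s\in T:s\geq t\}$.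 An element is on a successor level if its height is a successor ordinal. The coarse wedge topology on $T$ is the topology whose subbase consists of all sets $V_t$ and their complements, where $t$ is either minimal or on a successor level. A rooted chain complete tree is compact Hausdorff in this topology. A subset $A$ of a topological space $X$ is $\omega_1$-relatively discrete if it can be written as a union of $\omega_1$-many relatively discrete subsets of $X$ (sets that are discrete in the subspace topology). For a set $\Gamma$ let $\Sigma(\Gamma)=\{x\in\mathbb{R}^\Gamma:|\{\gamma\in\Gamma:x(\gamma)\neq 0\}|\leq\omega_0\}$. For a compact space $K$, a set $A\subset K$ is a $\Sigma$-subset of $K$ if there is a homeomorphic injection $h$ of $K$ into some $\mathbb{R}^\Gamma$ with $h(A)=h(K)\cap\Sigma(\Gamma)$. $K$ is Valdivia if it has a dense $\Sigma$-subset. *)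

(* Defs.v *)
From HB Require Import structures.
From mathcomp Require Import all_boot all_order all_algebra.
From mathcomp Require Import boolp classical_sets functions cardinality wochoice.
From mathcomp Require Import reals topology normedtype.

Set Implicit Arguments.
Unset Strict Implicit.
Unset Printing Implicit Defensive.

Import Order.TTheory GRing.Theory Num.Theory.
Import numFieldNormedType.Exports.

Local Open Scope classical_set_scope.

(** * Ordinals *)

(* An ordinal is represented by a well-ordered type; two of them denote the
   same ordinal when they are isomorphic ([ord_iso]). *)
Record ordtype := Ordtype {
  ord_sort :> Type;
  leo : rel ord_sort;
  leo_wo : well_order leo
}.
Arguments leo {o}.

Definition lto (a : ordtype) (x y : a) : bool := ~~ leo y x.

Lemma wo_chain_relpre (T : Type) (R : rel T) (A : {pred T}) :
  wo_chain R A -> @well_order {x | x \in A} (relpre sval R).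
Proof.
move=> woA B [b Bb].
pose B' : {pred T} := fun x => `[< exists2 y : {x | x \in A}, y \in B & sval y = x >].
have sB'A : {subset B' <= A} by move=> x /asboolP[[y Ay] _ <-].
have neB' : nonempty B' by exists (sval b); apply/asboolP; exists b.
have [m [[/asboolP[z Bz zm] mlb] muniq]] := woA B' sB'A neB'.
exists z; split; first split=> // y By.
  by rewrite /= zm; apply: mlb; apply/asboolP; exists y.
move=> y [By ylb]; apply: val_inj; rewrite [LHS]zm; apply: muniq; split.
  by apply/asboolP; exists y.
by move=> _ /asboolP[x Bx <-]; exact: ylb.
Qed.

(* The order type of a well-ordered subset. *)
Definition otype (T : Type) (R : rel T) (A : {pred T}) (woA : wo_chain R A) :
  ordtype := Ordtype (wo_chain_relpre woA).

Lemma ord_chain (a : ordtype) (A : {pred a}) : wo_chain leo A.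
Proof. by move=> B _; apply: leo_wo. Qed.

Definition osub (a : ordtype) (A : {pred a}) : ordtype := otype (@ord_chain a A).

Definition oseg (a : ordtype) (x : a) : ordtype := osub [pred y | lto y x].

Definition ord_iso (a b : ordtype) : Prop :=
  exists2 f : a -> b, bijective f & {mono f : x y / leo x y}.

Definition ord_lt (a b : ordtype) : Prop := exists x : b, ord_iso a (oseg x).

Definition ord_le (a b : ordtype) : Prop := ord_lt a b \/ ord_iso a b.

Lemma leo_nat_wo : well_order leq.
Proof.
apply: antisymmetric_well_order => [x y|A [x Ax]]; first exact: anti_leq.
have exA : exists n, n \in A by exists x.
by case: (ex_minnP exA) => m Am mlb; exists m; split.
Qed.

Definition ord_omega : ordtype := Ordtype leo_nat_wo.

Lemma leo_void_wo : well_order (fun _ _ : void => true).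
Proof. by move=> A [[]]. Qed.

Definition ord_zero : ordtype := Ordtype leo_void_wo.

Definition leo_succ (a : ordtype) : rel (option a) := fun x y =>
  match x, y with
  | _, None => true
  | None, Some _ => false
  | Some x', Some y' => leo x' y'
  end.

Lemma leo_succ_wo (a : ordtype) : well_order (@leo_succ a).
Proof.
move=> A [x0 Ax0].
pose B : {pred a} := fun x => Some x \in A.
have [[x Bx]|nB] := pselect (nonempty B); last first.
  have A0 y : y \in A -> y = None.
    by case: y => // y Ay; case: nB; exists y.
  exists None; split; last by move=> y [/A0 -> _].
  split; first by rewrite -(A0 _ Ax0).
  by move=> y /A0 ->.
have [m [[Bm mlb] muniq]] := leo_wo (ex_intro _ x Bx).
exists (Some m); split; first by split=> // -[y|//] Ay; exact: mlb.
move=> [y|] [Ay ylb]; last by have := ylb _ Bm.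
by congr Some; apply: muniq; split=> // z Bz; exact: ylb Bz.
Qed.

Definition ord_succ (a : ordtype) : ordtype := Ordtype (@leo_succ_wo a).

Definition is_succ (a : ordtype) : Prop := exists b, ord_iso a (ord_succ b).

Definition ord_least (P : ordtype -> Prop) (a : ordtype) : Prop :=
  P a /\ forall b, P b -> ord_le a b.

(* The least ordinal satisfying [P], up to isomorphism; [ord_zero] if there is
   none, but see [ord_minP]. *)
Definition ord_min (P : ordtype -> Prop) : ordtype :=
  match pselect (exists a, ord_least P a) with
  | left exP => projT1 (cid exP)
  | right _ => ord_zero
  end.

(* [omega n] is the initial ordinal omega_n. *)
Fixpoint omega (n : nat) : ordtype :=
  match n with
  | 0 => ord_omega
  | m.+1 => ord_min (fun a => ~ ([set: a] #<= [set: omega m])%card)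
  end.

Definition cofinal (a : ordtype) (C : {pred a}) : Prop :=
  forall x, exists2 c, c \in C & leo x c.

Definition cof (a : ordtype) : ordtype :=
  ord_min (fun b => exists2 C : {pred a}, cofinal C & ord_iso b (osub C)).

(** ** Comparability of ordinals, and existence of the minima above *)

Lemma leo_min (a : ordtype) (P : a -> Prop) :
  (exists x, P x) -> exists2 m, P m & forall x, P x -> leo m x.
Proof.
move=> [x Px]; pose A : {pred a} := fun x => `[< P x >].
have [|m [[/asboolP Pm mlb] _]] := @leo_wo a A; first by exists x; apply/asboolP.
by exists m => // y Py; apply: mlb; apply/asboolP.
Qed.

Lemma leo_refl (a : ordtype) (x : a) : leo x x.
Proof. by have [|m -> mlb] := @leo_min a (fun y => y = x); [exists x|exact: mlb]. Qed.

Lemma leo_total (a : ordtype) (x y : a) : leo x y || leo y x.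
Proof.
have [|m mxy mlb] := @leo_min a (fun z => z = x \/ z = y); first by exists x; left.
by case: mxy mlb => -> mlb; apply/orP; [left|right]; apply: mlb; [right|left].
Qed.

Lemma leo_anti (a : ordtype) (x y : a) : leo x y -> leo y x -> x = y.
Proof.
move=> xy yx; pose A : {pred a} := fun z => `[< z = x \/ z = y >].
have [|m [_ muniq]] := @leo_wo a A; first by exists x; apply/asboolP; left.
transitivity m; [symmetry|]; apply: muniq; split.
- by apply/asboolP; left.
- by move=> _ /asboolP[] -> //; exact: leo_refl.
- by apply/asboolP; right.
- by move=> _ /asboolP[] -> //; exact: leo_refl.
Qed.

Lemma leo_trans (a : ordtype) (y x z : a) : leo x y -> leo y z -> leo x z.
Proof.
move=> xy yz.
have [|m mxyz mlb] := @leo_min a (fun t => [\/ t = x, t = y | t = z]).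
  by exists x; constructor 1.
case: mxyz mlb => -> mlb.
- by apply: mlb; constructor 3.
- by rewrite (leo_anti xy (mlb _ _)) //; constructor 1.
- by rewrite -(leo_anti yz (mlb _ _)) //; constructor 2.
Qed.

Lemma ltoW (a : ordtype) (x y : a) : lto x y -> leo x y.
Proof. by move=> xy; have := leo_total x y; rewrite (negPf xy) orbF. Qed.

Lemma lto_le_trans (a : ordtype) (y x z : a) : lto x y -> leo y z -> lto x z.
Proof. by move=> xy yz; apply: contra xy; exact: leo_trans. Qed.

Lemma lto_irr (a : ordtype) (x : a) : lto x x = false.
Proof. by rewrite /lto leo_refl. Qed.

(* [r] is the graph of an order isomorphism from [A] onto [B]. *)
Definition iso_graph (a b : ordtype) (A : a -> Prop) (B : b -> Prop)
    (r : a -> b -> Prop) : Prop :=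
  [/\ forall x, A x -> exists2 y, B y & r x y,
      forall y, B y -> exists2 x, A x & r x y &
      forall x x' y y', A x -> A x' -> B y -> B y' -> r x y -> r x' y' ->
        leo x x' = leo y y'].

Definition below (a : ordtype) (x y : a) : Prop := lto y x.

Definition seg_iso (a b : ordtype) (x : a) (y : b) : Prop :=
  exists r, iso_graph (below x) (below y) r.

Lemma iso_graph_sym (a b : ordtype) (A : a -> Prop) (B : b -> Prop) r :
  iso_graph A B r -> iso_graph B A (fun y x => r x y).
Proof. by case=> rl rr rm; split=> // *; symmetry; exact: rm. Qed.

Lemma iso_graph_trans (a b c : ordtype) (A : a -> Prop) (B : b -> Prop)
    (C : c -> Prop) r s :
  iso_graph A B r -> iso_graph B C s ->
  iso_graph A C (fun x z => exists2 y, B y & r x y /\ s y z).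
Proof.
move=> [rl rr rm] [sl sr sm]; split.
- move=> x Ax; have [y By rxy] := rl _ Ax; have [z Cz syz] := sl _ By.
  by exists z => //; exists y.
- move=> z Cz; have [y By syz] := sr _ Cz; have [x Ax rxy] := rr _ By.
  by exists x => //; exists y.
- move=> x x' z z' Ax Ax' Cz Cz' [y By [rxy syz]] [y' By' [rxy' syz']].
  by rewrite (rm _ _ _ _ Ax Ax' By By' rxy rxy'); exact: sm.
Qed.

Lemma seg_iso_sym (a b : ordtype) (x : a) (y : b) : seg_iso x y -> seg_iso y x.
Proof. by case=> r /iso_graph_sym ?; eexists; eassumption. Qed.

Lemma seg_iso_trans (a b c : ordtype) (x : a) (y : b) (z : c) :
  seg_iso x y -> seg_iso y z -> seg_iso x z.
Proof. by case=> r ir [s] /(iso_graph_trans ir) ?; eexists; eassumption. Qed.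

Lemma iso_graph_lto (a b : ordtype) (A : a -> Prop) (B : b -> Prop) r x x' y y' :
  iso_graph A B r -> A x -> A x' -> B y -> B y' -> r x y -> r x' y' ->
  lto x x' = lto y y'.
Proof. by case=> _ _ rm *; congr negb; exact: rm. Qed.

Lemma seg_iso_restr (a b : ordtype) (A : a -> Prop) (B : b -> Prop) r x y :
  iso_graph A B r ->
  (forall z, lto z x -> A z) -> (forall z, lto z y -> B z) ->
  A x -> B y -> r x y -> seg_iso x y.
Proof.
move=> ir dA dB Ax By rxy; exists r; have [rl rr rm] := ir; split.
- move=> z zx; have [w Bw rzw] := rl _ (dA _ zx); exists w => //.
  by rewrite /below -(iso_graph_lto ir (dA _ zx) Ax Bw By rzw rxy).
- move=> w wy; have [z Az rzw] := rr _ (dB _ wy); exists z => //.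
  by rewrite /below (iso_graph_lto ir Az Ax (dB _ wy) By rzw rxy).
- by move=> ? ? ? ? /dA ? /dA ? /dB ? /dB ?; exact: rm.
Qed.

Lemma below_down (a : ordtype) (u x z : a) : below u x -> lto z x -> below u z.
Proof. by move=> xu zx; exact: lto_le_trans zx (ltoW xu). Qed.

Lemma seg_iso_below (a b : ordtype) (x x' : a) (y : b) :
  seg_iso x y -> lto x' x -> exists2 y', lto y' y & seg_iso x' y'.
Proof.
move=> [r ir] x'x; have [rl _ _] := ir; have [y' y'y rxy'] := rl _ x'x.
exists y' => //; apply: (seg_iso_restr ir) rxy' => //.
  by move=> z; exact: below_down.
by move=> z; exact: below_down.
Qed.

Lemma seg_iso_rigid (a : ordtype) (x x' : a) : lto x' x -> ~ seg_iso x x'.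
Proof.
move=> x'x [r ir]; have [rl _ _] := ir.
have [z zx' rx'z] := rl _ x'x.
pose P y := lto y x /\ exists2 w, lto w x' /\ lto w y & r y w.
have [|m [mx [w [wx' wm] rmw]] mmin] := @leo_min a P.
  by exists x'; split => //; exists z.
have wx : lto w x := below_down mx wm.
have [v vx' rwv] := rl _ wx.
suff /mmin mw : P w by rewrite /lto mw in wm.
split=> //; exists v => //; split=> //.
by rewrite -(iso_graph_lto ir wx mx vx' wx' rwv rmw).
Qed.

Lemma seg_iso_le (a b : ordtype) (x x' : a) (y y' : b) :
  seg_iso x y -> seg_iso x' y' -> leo x x' -> leo y y'.
Proof.
move=> xy xy' xx'; apply/negPn/negP => y'y.
have [x'' x''x /seg_iso_sym x''y'] := seg_iso_below (seg_iso_sym xy) y'y.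
apply: (@seg_iso_rigid _ x' x''); first exact: lto_le_trans xx'.
by apply: seg_iso_trans xy' _; exact: seg_iso_sym.
Qed.

Lemma seg_iso_graph (a b : ordtype) :
  iso_graph (fun x : a => exists y : b, seg_iso x y)
            (fun y : b => exists x : a, seg_iso x y) (@seg_iso a b).
Proof.
split.
- by move=> x [y xy]; exists y => //; exists x.
- by move=> y [x xy]; exists x => //; exists y.
- move=> x x' y y' _ _ _ _ xy xy'; apply/idP/idP; first exact: seg_iso_le.
  by apply: seg_iso_le; exact: seg_iso_sym.
Qed.

Lemma iso_graph_eq (a b : ordtype) (A A' : a -> Prop) (B B' : b -> Prop) r :
  (forall x, A x <-> A' x) -> (forall y, B y <-> B' y) ->
  iso_graph A B r -> iso_graph A' B' r.
Proof.
move=> AA' BB'.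
have <- : A = A' by apply/funext => ?; exact/propext.
by have <- : B = B' by apply/funext => ?; exact/propext.
Qed.

Lemma seg_iso_trichotomy (a b : ordtype) :
  [\/ exists r : a -> b -> Prop, iso_graph (fun=> True) (fun=> True) r,
      exists (y : b) (r : a -> b -> Prop), iso_graph (fun=> True) (below y) r |
      exists (x : a) (r : a -> b -> Prop), iso_graph (below x) (fun=> True) r].
Proof.
have ir := seg_iso_graph a b.
have dirl : (forall x : a, exists y : b, seg_iso x y) \/
    exists x0 : a, forall x, lto x x0 <-> exists y : b, seg_iso x y.
  have [?|nA] := pselect (forall x : a, exists y : b, seg_iso x y); [by left|right].
  have [|x0 nx0 x0min] := @leo_min a (fun x => ~ exists y : b, seg_iso x y).
    exact/existsNP.
  exists x0 => x; split=> [xx0|[y xy]].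
    by apply: contrapT => /x0min; rewrite (negbTE xx0).
  apply/negP => x0x; apply: nx0.
  have [xx0|x0x'] := boolP (leo x x0); first by exists y; rewrite -(leo_anti xx0 x0x).
  by have [y' _ ?] := seg_iso_below xy x0x'; exists y'.
have dirr : (forall y : b, exists x : a, seg_iso x y) \/
    exists y0 : b, forall y, lto y y0 <-> exists x : a, seg_iso x y.
  have [?|nA] := pselect (forall y : b, exists x : a, seg_iso x y); [by left|right].
  have [|x0 nx0 x0min] := @leo_min b (fun y => ~ exists x : a, seg_iso x y).
    exact/existsNP.
  exists x0 => x; split=> [xx0|[y xy]].
    by apply: contrapT => /x0min; rewrite (negbTE xx0).
  apply/negP => x0x; apply: nx0.
  have [xx0|x0x'] := boolP (leo x x0); first by exists y; rewrite -(leo_anti xx0 x0x).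
  have [y' _ /seg_iso_sym ?] := seg_iso_below (seg_iso_sym xy) x0x'.
  by exists y'.
case: dirl => [lall|[x0 lx0]]; case: dirr => [rall|[y0 ry0]].
- by constructor 1; exists (@seg_iso a b); apply: iso_graph_eq ir.
- constructor 2; exists y0, (@seg_iso a b); apply: iso_graph_eq ir => //.
  by move=> y; rewrite /below ry0.
- constructor 3; exists x0, (@seg_iso a b); apply: iso_graph_eq ir => //.
  by move=> x; rewrite /below lx0.
- have x0y0 : seg_iso x0 y0.
    exists (@seg_iso a b); apply: iso_graph_eq ir => ?; rewrite /below.
      by rewrite lx0.
    by rewrite ry0.
  by have := lto_irr x0; rewrite (lx0 x0).2 //; exists y0.
Qed.

Lemma iso_graph_ord_iso (a b : ordtype) (r : a -> b -> Prop) :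
  iso_graph (fun=> True) (fun=> True) r -> ord_iso a b.
Proof.
move=> [rl rr rm].
have /choice[f rf] : forall x, exists y, r x y by move=> x; have [] := rl x I; eauto.
have /choice[g rg] : forall y, exists x, r x y by move=> y; have [] := rr y I; eauto.
exists f => [|x y]; last by symmetry; exact: rm.
exists g => [x|y]; apply: leo_anti.
- by rewrite (rm _ _ _ _ I I I I (rg _) (rf _)) leo_refl.
- by rewrite (rm _ _ _ _ I I I I (rf _) (rg _)) leo_refl.
- by rewrite -(rm _ _ _ _ I I I I (rf _) (rg _)) leo_refl.
- by rewrite -(rm _ _ _ _ I I I I (rg _) (rf _)) leo_refl.
Qed.

Lemma ord_iso_graph (a b : ordtype) : ord_iso a b ->
  exists r : a -> b -> Prop, iso_graph (fun=> True) (fun=> True) r.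
Proof.
move=> [f [g fK gK] fm]; exists (fun x y => f x = y); split.
- by move=> x _; exists (f x).
- by move=> y _; exists (g y).
- by move=> x x' _ _ _ _ _ _ <- <-; rewrite fm.
Qed.

Lemma osub_graph (a : ordtype) (A : {pred a}) :
  iso_graph (fun=> True) (fun x => x \in A) (fun (x : osub A) y => sval x = y).
Proof.
split.
- by move=> [x Ax] _; exists x.
- by move=> y Ay; exists (exist _ y Ay).
- by move=> x x' _ _ _ _ _ _ <- <-.
Qed.

Lemma ord_isoP (a b : ordtype) : ord_iso a b <->
  exists r : a -> b -> Prop, iso_graph (fun=> True) (fun=> True) r.
Proof.
by split=> [/ord_iso_graph//|[r]]; exact: iso_graph_ord_iso.
Qed.

Lemma ord_ltP (a b : ordtype) : ord_lt a b <->
  exists (y : b) (r : a -> b -> Prop), iso_graph (fun=> True) (below y) r.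
Proof.
split=> [[y /ord_iso_graph[r ir]]|[y [r ir]]]; exists y.
  by have := iso_graph_trans ir (osub_graph _) => ?; eexists; eassumption.
have := iso_graph_trans ir (iso_graph_sym (osub_graph [pred z | lto z y])).
exact: iso_graph_ord_iso.
Qed.

Lemma ord_iso_refl (a : ordtype) : ord_iso a a.
Proof. by exists id => //; exists id. Qed.

Lemma ord_iso_sym (a b : ordtype) : ord_iso a b -> ord_iso b a.
Proof.
by move=> /ord_isoP[r /iso_graph_sym ?]; apply/ord_isoP; eexists; eassumption.
Qed.

Lemma ord_iso_trans (a b c : ordtype) : ord_iso a b -> ord_iso b c -> ord_iso a c.
Proof.
move=> /ord_isoP[r ir] /ord_isoP[s /(iso_graph_trans ir) ?].
by apply/ord_isoP; eexists; eassumption.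
Qed.

Lemma ord_trichotomy (a b : ordtype) : [\/ ord_iso a b, ord_lt a b | ord_lt b a].
Proof.
have [|[y [r ir]]|[x [r ir]]] := seg_iso_trichotomy a b.
- by move/ord_isoP; constructor 1.
- by constructor 2; apply/ord_ltP; exists y, r.
- constructor 3; apply/ord_ltP; exists x; eexists; exact: iso_graph_sym ir.
Qed.

Lemma ord_least_ex (P : ordtype -> Prop) :
  (exists a, P a) -> exists a, ord_least P a.
Proof.
move=> [a Pa].
have [exb|nb] := pselect (exists x : a, exists2 b, P b & ord_iso b (oseg x)); last first.
  exists a; split=> // b Pb.
  have [?|?|[x bx]] := ord_trichotomy a b; [by right|by left|].
  by case: nb; exists x, b.
have [m [b Pb bm] mmin] := leo_min exb.
exists b; split=> // c Pc.
have [?|?|/ord_ltP[y [s is_]]] := ord_trichotomy b c; [by right|by left|].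
have [r ir] : exists r : b -> a -> Prop, iso_graph (fun=> True) (below m) r.
  have [r ir] := ord_iso_graph bm.
  by have := iso_graph_trans ir (osub_graph _) => ?; eexists; eassumption.
have [rl rr rm] := ir.
have [x xm ryx] := rl y I.
have [t it] : exists t : b -> a -> Prop, iso_graph (below y) (below x) t.
  by apply: (seg_iso_restr ir) ryx => // z; exact: below_down.
suff /mmin : exists2 c, P c & ord_iso c (oseg x) by rewrite (negbTE xm).
exists c => //.
have := iso_graph_trans (iso_graph_trans is_ it)
  (iso_graph_sym (osub_graph [pred z | lto z x])).
exact: iso_graph_ord_iso.
Qed.

Lemma ord_minP (P : ordtype -> Prop) :
  (exists a, P a) -> ord_least P (ord_min P).
Proof.
move=> /ord_least_ex Pa; rewrite /ord_min; case: pselect => // h.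
by case: cid.
Qed.

(* No type bounds the cardinalities of all ordinals. *)
Lemma ord_unbounded (X : Type) :
  exists a : ordtype, forall f : a -> X, ~ injective f.
Proof.
have [R Rwo] := well_ordering_principle {eclassic X -> bool}.
exists (Ordtype Rwo) => /= f finj.
pose D : X -> bool := fun x => `[< exists s : X -> bool, f s = x /\ ~~ s x >].
have [fD|nfD] := boolP (D (f D)).
  have /asboolP[s [/finj sD]] := fD.
  by rewrite sD fD.
by move/asboolP : (nfD); apply; exists D.
Qed.

Lemma ord_unbounded_card (X : Type) :
  exists a : ordtype, ~ ([set: a] #<= [set: X])%card.
Proof.
have [a na] := ord_unbounded X; exists a => /card_leP[f].
apply: (na (fun x => sval (f (SigSub (mem_set (I : [set: a] x)))))) => x y.
by move=> /val_inj /(inj (f := f) (mem_set I) (mem_set I)) [].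
Qed.

Lemma omegaSP (n : nat) :
  ord_least (fun a => ~ ([set: a] #<= [set: omega n])%card) (omega n.+1).
Proof. by apply: ord_minP; exact: ord_unbounded_card. Qed.

Lemma cofP (a : ordtype) :
  ord_least (fun b => exists2 C : {pred a}, cofinal C & ord_iso b (osub C)) (cof a).
Proof.
pose A : {pred a} := predT; apply: ord_minP; exists (osub A), A.
  by move=> x; exists x => //; exact: leo_refl.
exact: ord_iso_refl.
Qed.

(** * Trees *)

HB.mixin Record isTree (d : Order.disp_t) T & Order.POrder d T := {
  tree_wo : forall t : T, wo_chain <=%O [pred s : T | (s < t)%O]
}.

#[short(type="treeType")]
HB.structure Definition Tree (d : Order.disp_t) :=
  {T of isTree d T & Order.POrder d T}.

Definition rooted (d : Order.disp_t) (T : treeType d) : Prop :=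
  exists! r : T, minimal <=%O r.

Definition chain_complete (d : Order.disp_t) (T : treeType d) : Prop :=
  forall A : set T, total_on A (fun x y => (x <= y)%O) -> supremums A !=set0.

Definition ht (d : Order.disp_t) (T : treeType d) (t : T) : ordtype :=
  otype (tree_wo t).

Definition Lev (d : Order.disp_t) (T : treeType d) (a : ordtype) : set T :=
  [set t | ord_iso (ht t) a].
Arguments Lev {d} T a.

Definition tree_ht (d : Order.disp_t) (T : treeType d) : ordtype :=
  ord_min (fun a => Lev T a = set0).
Arguments tree_ht {d} T.

Lemma tree_htP (d : Order.disp_t) (T : treeType d) :
  ord_least (fun a => Lev T a = set0) (tree_ht T).
Proof.
apply: ord_minP; have [a na] := ord_unbounded T; exists a.
rewrite -subset0 => t /ord_iso_sym[f /bij_inj finj _].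
by apply: (na (fun x => sval (f x))) => x y /val_inj /finj.
Qed.

(* Unlike [cof], the cofinality of an element on a successor level is 0. *)
Definition cf (d : Order.disp_t) (T : treeType d) (t : T) : ordtype :=
  if pselect (is_succ (ht t)) then ord_zero else cof (ht t).

Definition ims (d : Order.disp_t) (T : treeType d) (t : T) : set T :=
  [set s | (t < s)%O /\ ord_iso (ht s) (ord_succ (ht t))].

Definition wedge (d : Order.disp_t) (T : treeType d) (t : T) : set T :=
  [set s | (t <= s)%O].

Definition coarse_subbase (d : Order.disp_t) (T : treeType d) : set (set T) :=
  [set A | exists2 t : T, minimal <=%O t \/ is_succ (ht t)
                        & A = wedge t \/ A = ~` wedge t].
Arguments coarse_subbase {d} T.

Definition coarse_wedge (d : Order.disp_t) (T : treeType d) : Type := T.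

HB.instance Definition _ (d : Order.disp_t) (T : treeType d) :=
  Choice.on (coarse_wedge T).
HB.instance Definition _ (d : Order.disp_t) (T : treeType d) :=
  @isSubBaseTopological.Build (coarse_wedge T) (set T) (coarse_subbase T) id.

Definition Rset (d : Order.disp_t) (T : treeType d) : set T :=
  [set t | ord_iso (cf t) (omega 1) /\ ims t !=set0].
Arguments Rset {d} T.

(** * Topological notions *)

(* [set_type A] carries the subspace topology. *)
Definition relatively_discrete (X : topologicalType) (A : set X) : Prop :=
  forall B : set (set_type A), open B.

Definition omega1_relatively_discrete (X : topologicalType) (A : set X) : Prop :=
  exists2 D : omega 1 -> set X,
    (forall i, relatively_discrete (D i)) & A = \bigcup_i D i.

Definition Sigma (R : realType) (Gamma : Type) : set {ptws Gamma -> R} :=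
  [set x | countable [set g | x g <> 0%R]].
Arguments Sigma : clear implicits.

Definition homeo_injection (X Y : topologicalType) (h : X -> Y) : Prop :=
  [/\ injective h, continuous h &
      forall U, open U -> exists2 W, open W & h @` U = range h `&` W].

Definition sigma_subset (R : realType) (K : topologicalType) (A : set K) : Prop :=
  exists (Gamma : Type) (h : K -> {ptws Gamma -> R}),
    homeo_injection h /\ h @` A = range h `&` Sigma R Gamma.

Definition valdivia (R : realType) (K : topologicalType) : Prop :=
  compact [set: K] /\ exists2 A : set K, dense A & sigma_subset R A.

(* Main.v *)
(* Necessity.  Let [h] embed [T] in R^Gamma and let A be the set of points whose
   image has countable support.  A is closed under suprema of strictly increasing
   sequences, but contains no point of uncountable cofinality: a countable
   closing-off argument would yield y < x with h y = h x.  If ims t were infinite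
   for some t in R, then t would be a limit of a sequence of points of A, chosen
   above distinct immediate successors.  A point t in R at level alpha is coded by
   x < t in A and a coordinate g, nonzero at x and t but zero at some a > t in A;
   the code only involves the height of x and the rank of g in the support of x,
   and points of the same code are isolated from one another.  Finally, below a
   point of height omega_2 one could close off omega_1 times under supports and
   reach a point of A of cofinality omega_1.

   Sufficiency.  Points of R on a fixed level can be given pairwise disjoint
   intervals [g t, t).  Fix ladders (cofinal sets with countable proper initial
   segments) at all ordinals up to ht(T).  A point s on a successor level gets the
   clopen set of all x >= s that are not above any t in R such that ht t lies on
   the minimal walk from the top to ht s and g t <= s < t; there are finitely many
   such t.  These clopen sets separate points, and each point on a successor level
   is in only countably many of them. *)
Require Import Defs.
From mathcomp Require Import all_boot all_order all_algebra.
From mathcomp Require Import boolp classical_sets functions cardinality wochoice.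
From mathcomp Require Import reals topology normedtype.

Set Implicit Arguments.
Unset Strict Implicit.
Unset Printing Implicit Defensive.

Import Order.TTheory GRing.Theory Num.Theory.
Import numFieldNormedType.Exports.
Local Open Scope classical_set_scope.

(** * Ordinals *)

Lemma below_ord (a : ordtype) (P : a -> Prop) :
  (forall x, (forall y, lto y x -> P y) -> P x) -> forall x, P x.
Proof.
move=> IH x; apply: contrapT => nPx.
have [|m nPm mmin] := @leo_min a (fun x => ~ P x); first by exists x.
apply: nPm; apply: IH => y ym; apply: contrapT => /mmin; exact/negP.
Qed.

Lemma lto_trans (a : ordtype) (y x z : a) : lto x y -> lto y z -> lto x z.
Proof. by move=> xy /ltoW; apply: lto_le_trans. Qed.

Lemma leo_lto_trans (a : ordtype) (y x z : a) : leo x y -> lto y z -> lto x z.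
Proof. by move=> xy; apply: contra => /leo_trans; apply. Qed.

Lemma leo_eqVlt (a : ordtype) (x y : a) : leo x y -> x = y \/ lto x y.
Proof.
move=> xy; have [yx|nyx] := boolP (leo y x); [left; exact: leo_anti | by right].
Qed.

Lemma ltoP (a : ordtype) (x y : a) : [\/ lto x y, x = y | lto y x].
Proof.
have [xy|] := boolP (leo x y); last by constructor 3.
by have [->|?] := leo_eqVlt xy; [constructor 2|constructor 1].
Qed.

Lemma ord_lt_le_trans (a b c : ordtype) : ord_lt a b -> ord_le b c -> ord_lt a c.
Proof.
move=> /ord_ltP[y [r ir]] bc; apply/ord_ltP.
have [B [s [is_ dB]]] : exists B s, @iso_graph b c (fun=> True) B s /\
    forall z w, B z -> lto w z -> B w.
  case: bc => [/ord_ltP[z [s is_]]|/ord_isoP[s is_]].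
    by exists (below z), s; split=> // u v; exact: below_down.
  by exists (fun=> True), s.
have [sl _ _] := is_; have [z Bz syz] := sl y I.
have [t it] : seg_iso y z.
  by apply: (seg_iso_restr is_) syz => // w wz; apply: dB wz.
exists z; eexists; exact: iso_graph_trans ir it.
Qed.

Lemma ord_lt_irr (a : ordtype) : ~ ord_lt a a.
Proof.
move=> /ord_ltP[y [r ir]]; have [rl _ _] := ir; have [z zy ryz] := rl y I.
apply: (seg_iso_rigid zy); apply: (seg_iso_restr ir) ryz => // w.
exact: below_down.
Qed.

Lemma ord_lt_not_le (a b : ordtype) : ord_lt a b -> ~ ord_le b a.
Proof. by move=> ab /(ord_lt_le_trans ab) /ord_lt_irr. Qed.

Lemma ord_le_anti (a b : ordtype) : ord_le a b -> ord_le b a -> ord_iso a b.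
Proof. by case=> // ab /(ord_lt_not_le ab). Qed.

Lemma ord_notlt_le (a b : ordtype) : ~ ord_lt a b -> ord_le b a.
Proof.
by case: (ord_trichotomy a b) => [/ord_iso_sym|//|]; [right|left].
Qed.

Lemma oseg_lt (a : ordtype) (x : a) : ord_lt (oseg x) a.
Proof. by exists x; exact: ord_iso_refl. Qed.

Lemma oseg_isoP (a b : ordtype) (x : a) (y : b) :
  ord_iso (oseg x) (oseg y) <-> seg_iso x y.
Proof.
have gx := osub_graph [pred z | lto z x]; have gy := osub_graph [pred z | lto z y].
split=> [/ord_isoP[r ir]|[r ir]].
  by eexists; exact: iso_graph_trans (iso_graph_trans (iso_graph_sym gx) ir) gy.
by apply: iso_graph_ord_iso; exact: iso_graph_trans (iso_graph_trans gx ir) (iso_graph_sym gy).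
Qed.

Lemma oseg_inj (a : ordtype) (x y : a) : ord_iso (oseg x) (oseg y) -> x = y.
Proof.
move=> /oseg_isoP xy; case: (ltoP x y) => // [/seg_iso_rigid|/seg_iso_rigid] [//].
exact: seg_iso_sym.
Qed.

Lemma ord_le_inj (a b : ordtype) : ord_le a b -> exists f : a -> b, injective f.
Proof.
case=> [[y [f /bij_inj finj _]]|[f /bij_inj finj _]]; last by exists f.
by exists (fun x => sval (f x)) => x z /val_inj /finj.
Qed.

Lemma countable_inj (X Y : Type) (f : X -> Y) (A : set X) (B : set Y) :
  (forall x, A x -> B (f x)) ->
  (forall x y, A x -> A y -> f x = f y -> x = y) -> countable B -> countable A.
Proof.
move=> fAB finj /countable_injP[g ginj]; apply/countable_injP; exists (g \o f).
move=> x y /set_mem Ax /set_mem Ay /= /ginj gxy; apply: finj => //.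
by apply: gxy; apply/mem_set; exact: fAB.
Qed.

Lemma countable_setU (X : Type) (A B : set X) :
  countable A -> countable B -> countable (A `|` B).
Proof.
move=> cA cB; rewrite -bigcup2E.
by apply: bigcup_countable => // -[|[|n]].
Qed.

Lemma ord_lt_omegaS (n : nat) (a : ordtype) :
  ord_lt a (omega n.+1) -> ([set: a] #<= [set: omega n])%card.
Proof.
by move=> an; apply: contrapT => /(omegaSP n).2 /(ord_lt_not_le an).
Qed.

Lemma omega1_uncountable : ~ countable [set: omega 1].
Proof. exact: (omegaSP 0).1. Qed.

Lemma omega1_seg_countable (i : omega 1) : countable [set j | lto j i].
Proof.
have c : countable [set: oseg i] by exact: (ord_lt_omegaS (oseg_lt i)).
have -> : [set j | lto j i] = (@sval _ _) @` [set: oseg i].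
  by apply/seteqP; split=> [j ji|_ [[j ji] _ <-]//]; exists (exist _ j ji).
by apply: sub_countable c; exact: card_image_le.
Qed.

Lemma omega1_seg_countable_le (i : omega 1) : countable [set j | leo j i].
Proof.
have -> : [set j | leo j i] = [set j | lto j i] `|` [set i].
  apply/seteqP; split=> [j /leo_eqVlt[->|]|j [/ltoW//|->]]; [by right|by left|].
  exact: leo_refl.
by apply: countable_setU; [exact: omega1_seg_countable|exact: countable1].
Qed.

(** Otherwise [omega 1] would be isomorphic to a proper initial segment of [a], which is
    countable. *)
Lemma ord_le_omega1 (a : ordtype) :
  (forall x : a, countable [set y | lto y x]) -> ord_le a (omega 1).
Proof.
move=> ca; apply: ord_notlt_le => -[x [f /bij_inj finj _]].
apply: omega1_uncountable; apply: countable_inj (ca x) => [i _|i j _ _].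
  exact: (svalP (f i)).
by move/val_inj/finj.
Qed.

(** * Sets of cardinality at most omega_1 *)

Definition small (X : Type) := exists f : X -> omega 1, injective f.

(** Order [X] by [m] first and by an arbitrary well-order inside each fibre. Initial segments lie in
    countable unions of countable fibres, so the order type is at most omega_1. *)
Lemma countable_small (X : Type) (m : X -> omega 1) :
  (forall i, countable [set x | m x = i]) -> small X.
Proof.
move=> cm; have [r rwo] := well_ordering_principle {classic X}.
pose o := Ordtype rwo.
pose R : rel X := fun x y => lto (m x) (m y) || `[< m x = m y >] && r x y.
have Rwo : well_order R.
  apply: (@antisymmetric_well_order X R) => [x y|B [x Bx]].
    rewrite /R => /andP[/orP[xy|/andP[/asboolP xy rxy]]].
      move=> /orP[yx|/andP[/asboolP yx _]].
        by have := lto_trans xy yx; rewrite lto_irr.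
      by rewrite yx lto_irr in xy.
    rewrite xy lto_irr /= => /andP[_ ryx].
    exact: (@leo_anti o).
  have [i [z Bz iz] imin] := @leo_min (omega 1) (fun i => exists2 z, z \in B & m z = i)
    (ex_intro _ (m x) (ex_intro2 _ _ x Bx erefl)).
  have [w [Bw iw] wmin] := @leo_min o (fun w => w \in B /\ m w = i)
    (ex_intro _ z (conj Bz iz)).
  exists w; split=> // y By.
  have /leo_eqVlt[iy|iy] := imin (m y) (ex_intro2 _ _ y By erefl).
    apply/orP; right; apply/andP; split; first by apply/asboolP; rewrite iw.
    exact: wmin.
  by apply/orP; left; rewrite iw.
have [|f finj] := @ord_le_inj (Ordtype Rwo) (omega 1); last by exists f.
apply: ord_le_omega1 => x.
apply: (@sub_countable _ _ _ (\bigcup_(i in [set i | leo i (m x)]) [set y | m y = i])).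
  apply: subset_card_le => y; rewrite /= /lto /= /R negb_or => /andP[xy _].
  by exists (m y) => //=; move: xy; rewrite /lto negbK.
by apply: bigcup_countable => // ; exact: omega1_seg_countable_le.
Qed.

Lemma countable_setT (X : Type) (f : X -> nat) : injective f -> countable [set: X].
Proof. by move=> finj; apply/countable_injP; exists f => x y _ _ /finj. Qed.

Lemma omega1_inhabited : inhabited (omega 1).
Proof.
apply: contrapT => no; apply: omega1_uncountable.
by apply: (@countable_setT _ (fun=> 0)) => x; case: no.
Qed.

Lemma countable_enum (X : Type) (A : set X) : countable A -> A !=set0 ->
  exists y : nat -> X, (forall n, A (y n)) /\ forall x, A x -> exists n, y n = x.
Proof.
move=> /countable_injP[f finj] [x0 Ax0].
have /choice[y yP] : forall n, exists x, A x /\ ((exists2 x', A x' & f x' = n) -> f x = n).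
  move=> n; have [[x' Ax' fx']|nx] := pselect (exists2 x', A x' & f x' = n).
    by exists x'.
  by exists x0; split.
exists y; split=> [n|x Ax]; first by case: (yP n).
exists (f x); have [Ay fy] := yP (f x).
by apply: finj; rewrite ?inE//; apply: fy; exists x.
Qed.

Lemma small_prod (X Y : Type) : small X -> small Y -> small (X * Y).
Proof.
have small2 : small (omega 1 * omega 1).
  (* The fibre of the maximum over [i] lies in the square of the countable segment up to [i]. *)
  pose mx (p : omega 1 * omega 1) := if leo p.1 p.2 then p.2 else p.1.
  apply: (@countable_small _ mx) => i.
  apply: (@sub_countable _ _ _ ([set j | leo j i] `*` [set j | leo j i])).
    apply: subset_card_le => -[j k] /= <-; rewrite /mx /=.
    case: ifPn => [jk|kj]; split=> //=; [exact: leo_refl|exact: leo_refl|exact: ltoW].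
  by apply: countableX; exact: omega1_seg_countable_le.
move=> [f finj] [g ginj]; have [h hinj] := small2.
exists (fun p => h (f p.1, g p.2)) => -[x y] [x' y'] /hinj /= [] /finj -> /ginj ->.
by [].
Qed.

Lemma ord_le_trans (b a c : ordtype) : ord_le a b -> ord_le b c -> ord_le a c.
Proof.
move=> [ab bc|ab]; first by left; exact: ord_lt_le_trans bc.
move=> [bc|bc]; last by right; exact: ord_iso_trans bc.
left; case: bc => x bx; exists x; exact: ord_iso_trans bx.
Qed.

Lemma small_nat : small nat.
Proof.
apply: (@ord_le_inj ord_omega); apply: ord_le_omega1 => x; exact: countableP.
Qed.

Lemma small_card (a : ordtype) : ([set: a] #<= [set: omega 1])%card -> small a.
Proof.
move=> /card_leP[f]; exists (fun x => sval (f (SigSub (mem_set (I : [set: a] x))))).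
by move=> x y /val_inj /(inj (f := f) (mem_set I) (mem_set I)) [].
Qed.

Lemma small_lt_omega2 (a : ordtype) : ord_lt a (omega 2) -> small a.
Proof. by move=> /ord_lt_omegaS /small_card. Qed.

(** * Records and cofinality omega_1 *)

(** The value at [c] is the least one that [e] takes on [D] from [c] onwards; hence an injective [e]
    is strictly increasing along records. *)
Definition is_record (a : ordtype) (e : a -> omega 1) (D : set a) (c : a) :=
  D c /\ forall c', D c' -> lto (e c') (e c) -> lto c' c.

(** Among the points of [D] from [x] on, one with the least value of [e] is a record. *)
Lemma record_cofinal (a : ordtype) (e : a -> omega 1) (D : set a) (x : a) :
  D x -> exists2 c, is_record e D c & leo x c.
Proof.
move=> Dx; have [|i [c Dc [xc ci]] imin] :=
    @leo_min (omega 1) (fun i => exists2 c, D c & leo x c /\ e c = i).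
  by exists (e x), x => //; split=> //; exact: leo_refl.
exists c => //; split=> // c' Dc' c'c; apply: lto_le_trans (xc).
apply/negP => xc'; have : leo i (e c') by apply: imin; exists c'.
by rewrite -ci; apply/negP.
Qed.

Lemma record_seg_countable (a : ordtype) (e : a -> omega 1) (D : set a) (c : a) :
  injective e -> is_record e D c -> countable [set c' | is_record e D c' /\ leo c' c].
Proof.
move=> einj [Dc rc]; apply: countable_inj (omega1_seg_countable_le (e c)).
- move=> c' [[Dc' rc'] c'c] /=; apply/negPn/negP => /(rc' _ Dc).
  by rewrite /lto c'c.
- by move=> x y _ _ /einj.
Qed.

Definition countably_bounded (a : ordtype) :=
  forall y : nat -> a, exists z, forall n, lto (y n) z.

(** Upper bound: the records of an injection into omega_1 are cofinal and have countable initial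
    segments. Lower bound: a countable cofinal set would be enumerated by an unbounded sequence. *)
Lemma cof_omega1 (a : ordtype) (x0 : a) :
  countably_bounded a -> small a -> ord_iso (cof a) (omega 1).
Proof.
move=> ba [e einj]; have [[C' C'cof isoC'] cofmin] := cofP a.
apply: ord_le_anti.
  pose C : {pred a} := fun c => `[< is_record e setT c >].
  apply: (@ord_le_trans (osub C)).
    apply: cofmin; exists C; last exact: ord_iso_refl.
    move=> x; have [//|c rc xc] := @record_cofinal a e setT x.
    by exists c => //; apply/asboolP.
  apply: ord_le_omega1 => -[c Cc].
  have /asboolP rc : `[< is_record e setT c >] by exact: Cc.
  apply: (@countable_inj _ _ (fun u : osub C => sval u)) (record_seg_countable einj rc).
    by move=> [c' Cc'] /ltoW c'c; split=> //; apply/asboolP; exact: Cc'.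
  by move=> x y _ _ /val_inj.
apply: (omegaSP 0).2 => c; have [x1 Cx1 _] := C'cof x0.
have cC' : countable [set x | x \in C'].
  have [f [g fK gK] _] := isoC'.
  have -> : [set x | x \in C'] = range (fun x => sval (f x)).
    apply/seteqP; split=> [x Cx|_ [x _ <-]]; last exact: (svalP (f x)).
    by exists (g (exist _ x Cx)) => //; rewrite gK.
  by apply: sub_countable c; exact: card_image_le.
have [|y [_ yC']] := countable_enum cC'; first by exists x1.
have [z zub] := ba y; have [c' /yC'[n <-] zc'] := C'cof z.
by move: (zub n); rewrite /lto zc'.
Qed.

Lemma cof_countably_bounded (a : ordtype) :
  ord_iso (cof a) (omega 1) -> inhabited a /\ countably_bounded a.
Proof.
have [[C' C'cof isoC'] cofmin] := cofP a => cofa; split.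
  have [i] := omega1_inhabited; have [f _ _] := ord_iso_trans (ord_iso_sym cofa) isoC'.
  by have [x _] := f i.
move=> y; apply: contrapT => nb; apply: omega1_uncountable.
pose C : {pred a} := fun x => `[< exists n, y n = x >].
have /cofmin /(ord_le_trans (or_intror (ord_iso_sym cofa))) :
    exists2 D : {pred a}, cofinal D & ord_iso (osub C) (osub D).
  exists C => [x|]; last exact: ord_iso_refl.
  apply: contrapT => nx; apply: nb; exists x => n; apply/negP => xy; apply: nx.
  by exists (y n) => //; apply/asboolP; exists n.
move=> /ord_le_inj[f finj].
apply: (@countable_inj _ _ (fun i => sval (f i)) _ (range y)).
- move=> i _; have /asboolP[n yn] : `[< exists n, y n = sval (f i) >] := svalP (f i).
  by exists n.
- by move=> i j _ _ /val_inj /finj.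
- by apply: sub_countable (card_image_le _ _) _; exact: countableP.
Qed.

Lemma wf_lto (a : ordtype) : well_founded (fun x y : a => lto x y).
Proof. by move=> x; elim/below_ord : x => x IH; split. Qed.

(** Transfinite recursion whose step sees only the set of earlier values, which suffices for closing
    off omega_1 times. *)
Lemma ord_recursion (a : ordtype) (X : Type) (step : set X -> X) :
  exists e : a -> X, forall i, e i = step [set e j | j in [set j | lto j i]].
Proof.
pose F i (f : forall j : a, lto j i -> X) :=
  step [set x | exists j (ji : lto j i), f j ji = x].
have FE i f g : (forall j ji, f j ji = g j ji) -> F i f = F i g.
  move=> fg; congr step; apply/seteqP.
  by split=> x [j [ji <-]]; exists j, ji; rewrite fg.
exists (Fix (@wf_lto a) (fun=> X) F) => i; rewrite Fix_eq//.
by congr step; apply/seteqP; split=> [x [j [ji <-]]|x [j ji <-]]; exists j => //; exists ji.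
Qed.

(** * Trees and the coarse wedge topology *)

Lemma ord_succ_max (b : ordtype) (m : b) :
  (forall x, leo x m) -> ord_iso b (ord_succ (oseg m)).
Proof.
move=> mmax.
pose r (x : b) (o : ord_succ (oseg m)) := if o is Some z then sval z = x else x = m.
apply: (@iso_graph_ord_iso _ _ r); split.
- move=> x _; have [->|xm] := leo_eqVlt (mmax x); first by exists None.
  by exists (Some (exist (fun y => y \in [pred y | lto y m]) x xm)).
- by move=> [z|] _; [exists (sval z)|exists m].
- move=> x x' [z|] [z'|] _ _ _ _ /= => [<- <-//|<- ->|-> <-|-> ->]; first exact: mmax.
    by apply/negbTE; exact: (svalP z').
  exact: leo_refl.
Qed.

Lemma ord_iso_succ (a b : ordtype) : ord_iso b (ord_succ a) ->
  exists m : b, (forall x, leo x m) /\ ord_iso a (oseg m).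
Proof.
move=> [f [g fK gK] fm]; exists (g None); split=> [x|].
  by rewrite -fm gK; case: (f x).
have ir : iso_graph (fun=> True) (below (g None)) (fun (x : a) y => f y = Some x).
  split.
  - by move=> x _; exists (g (Some x)); rewrite ?gK// /below /lto -fm !gK.
  - move=> y; rewrite /below /lto -fm gK; case fy: (f y) => [x|//] _.
    by exists x.
  - by move=> x x' y y' _ _ _ _ fy fy'; rewrite -fm fy fy'.
apply: iso_graph_ord_iso.
exact: iso_graph_trans ir (iso_graph_sym (osub_graph [pred z | lto z (g None)])).
Qed.

Section Tree.
Context {d : Order.disp_t} {T : treeType d}.
Implicit Types s t x y z u v : T.

Lemma tree_total t x y : (x <= t)%O -> (y <= t)%O -> (x <= y)%O || (y <= x)%O.
Proof.
rewrite !le_eqVlt => /predU1P[->|xt] /predU1P[->|yt]; rewrite ?eqxx ?xt ?yt ?orbT//.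
have := wo_chainW (tree_wo t) xt yt.
by rewrite !le_eqVlt.
Qed.

Lemma tree_ltNge t x y : (x <= t)%O -> (y <= t)%O -> ~~ (x <= y)%O -> (y < x)%O.
Proof.
move=> xt yt; case/orP: (tree_total xt yt) => [->//|yx nxy].
by rewrite lt_def yx andbT; apply: contra nxy => /eqP ->.
Qed.

Lemma tree_min t (P : T -> Prop) : (exists2 x, (x <= t)%O & P x) ->
  exists2 m, (m <= t)%O /\ P m & forall x, (x <= t)%O -> P x -> (m <= x)%O.
Proof.
move=> [x xt Px]; have [[y yt Py]|nP] := pselect (exists2 y, (y < t)%O & P y); last first.
  have tP y : (y <= t)%O -> P y -> y = t.
    by rewrite le_eqVlt => /predU1P[//|yt Py]; case: nP; exists y.
  exists x => //= y yt Py; by rewrite (tP _ xt Px) (tP _ yt Py).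
pose B : {pred T} := fun y => (y < t)%O && `[< P y >].
have [||m [[/andP[mt /asboolP Pm] mlb] _]] := @tree_wo d T t B.
- by move=> z /andP[].
- by exists y; apply/andP; split=> //; exact/asboolP.
exists m; first by rewrite ltW.
move=> z; rewrite le_eqVlt => /predU1P[-> _|zt Pz]; first exact: ltW.
by apply: mlb; apply/andP; split=> //; exact/asboolP.
Qed.

(** Immediate succession in terms of the order alone; [covers_ht] identifies it with [ims]. *)
Definition covers t s := (t < s)%O /\ forall z, (z < s)%O -> (z <= t)%O.

Lemma covers_ex t x : (t < x)%O -> exists2 s, covers t s & (s <= x)%O.
Proof.
move=> tx; have [|s [sx ts] smin] := @tree_min x (fun s => t < s)%O; first by exists x.
exists s => //; split=> // z zs; apply/negPn/negP => nzt.
have zx := le_trans (ltW zs) sx.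
have /(smin _ zx) := tree_ltNge zx (ltW tx) nzt.
by rewrite (lt_geF zs).
Qed.

Lemma covers_le t s x : covers t s -> (t < x)%O -> (x <= s)%O -> x = s.
Proof.
move=> [_ cts] tx; rewrite le_eqVlt => /predU1P[//|/cts].
by rewrite (lt_geF tx).
Qed.

Definition limit x := (exists y, (y < x)%O) /\
  forall y, (y < x)%O -> exists2 z, (y < z)%O & (z < x)%O.

(* [t] has uncountable cofinality. *)
Definition big t := (exists y, (y < t)%O) /\
  forall y : nat -> T, (forall n, y n < t)%O ->
    exists2 z, (z < t)%O & forall n, (y n < z)%O.

Lemma big_limit t : big t -> limit t.
Proof.
by move=> [ex bt]; split=> // y yt; have [_|z zt yz] := bt (fun=> y); [|exists z; rewrite ?(yz 0)].
Qed.

Lemma limit_ncovers t s : covers t s -> ~ limit s.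
Proof. by move=> [ts cts] [_ /(_ _ ts)[z tz /cts]]; rewrite (lt_geF tz). Qed.

Lemma limitVcovers x : [\/ forall y, ~~ (y < x)%O, exists t, covers t x | limit x].
Proof.
have [ex|nex] := pselect (exists y, (y < x)%O); last first.
  by constructor 1 => y; apply/negP => yx; apply: nex; exists y.
have [lx|nlx] := pselect (limit x); first by constructor 3.
constructor 2; apply: contrapT => ncov; apply: nlx; split=> // y yx.
have [s cys] := covers_ex yx; rewrite le_eqVlt => /predU1P[sx|sx].
  by case: ncov; exists y; rewrite -sx.
by exists s => //; case: cys.
Qed.

Section LimitPoints.
Hypothesis chainT : chain_complete T.

Lemma seg_total x : total_on [set y | (y < x)%O] (fun x y => (x <= y)%O).
Proof. by move=> y z /ltW yx /ltW zx; apply/orP; exact: tree_total yx zx. Qed.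

(** The supremum of the predecessors of [x] is [x] itself: if it were smaller, some predecessor of
    [x] would exceed it. *)
Lemma limit_sup x u : limit x -> (forall y, (y < x)%O -> (y <= u)%O) -> (x <= u)%O.
Proof.
move=> [_ lx] xu; have [v [vub vlub]] := chainT (@seg_total x).
have vx : (v <= x)%O by apply: vlub => y /ltW.
have vu : (v <= u)%O by apply: vlub.
move: vx; rewrite le_eqVlt => /predU1P[<-//|/lx[z vz zx]].
by have := vub _ zx; rewrite (lt_geF vz).
Qed.

Lemma limit_split x u : limit x -> ~~ (x <= u)%O -> exists2 y, (y < x)%O & ~~ (y <= u)%O.
Proof.
move=> lx xu; apply: contrapT => nex; move/negP: xu; apply; apply: limit_sup lx _.
by move=> y yx; apply: contrapT => /negP nyu; apply: nex; exists y.
Qed.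

End LimitPoints.

(** * Heights of predecessors and successors *)

Definition seg_elt t s (st : (s < t)%O) : ht t :=
  exist (fun x => x \in [pred s | (s < t)%O]) s st.

Lemma seg_lt t (x : ht t) : (sval x < t)%O.
Proof. exact: (svalP x). Qed.

Lemma ht_seg_lt t (x y : ht t) : lto x y = (sval x < sval y)%O.
Proof.
have xt := svalP x; have yt := svalP y; rewrite /lto /=.
apply/idP/idP => [|/lt_geF ->//].
exact: tree_ltNge (ltW yt) (ltW xt).
Qed.

Lemma ht_seg t s (st : (s < t)%O) : ord_iso (ht s) (oseg (seg_elt st)).
Proof.
have ir : iso_graph (fun=> True) (below (seg_elt st)) (fun (x : ht s) (y : ht t) => sval x = sval y).
  split.
  - move=> [x xs] _; exists (seg_elt (lt_trans (xs : (x < s)%O) st)) => //.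
    by rewrite /below ht_seg_lt.
  - move=> [y yt]; rewrite /below ht_seg_lt /= => ys.
    by exists (seg_elt ys).
  - by move=> x x' y y' _ _ _ _ /= -> ->.
apply: iso_graph_ord_iso.
exact: iso_graph_trans ir (iso_graph_sym (osub_graph [pred z | lto z (seg_elt st)])).
Qed.

Lemma ht_lt s t : (s < t)%O -> ord_lt (ht s) (ht t).
Proof. by move=> st; exists (seg_elt st); exact: ht_seg. Qed.

Lemma ht_inj t s s' : (s <= t)%O -> (s' <= t)%O -> ord_iso (ht s) (ht s') -> s = s'.
Proof.
move=> st s't iss; have [ss'|nss'] := boolP (s <= s')%O; last first.
  by have /ht_lt/ord_lt_not_le[] := tree_ltNge st s't nss'; right.
move: ss'; rewrite le_eqVlt => /predU1P[//|/ht_lt/ord_lt_not_le[]].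
by right; exact: ord_iso_sym.
Qed.

Lemma covers_ht t s : covers t s <-> ims t s.
Proof.
split=> [[ts cts]|[ts]].
  split=> //; have mx (x : ht s) : leo x (seg_elt ts) by apply: cts; exact: (svalP x).
  have [f [g fK gK] fm] := ht_seg ts.
  apply: ord_iso_trans (ord_succ_max mx) _.
  pose h (o : ord_succ (oseg (seg_elt ts))) : ord_succ (ht t) := omap g o.
  exists h => [|[x|] [y|]] //; last by have := fm (g x) (g y); rewrite !gK => /esym E; exact: E.
  by exists (omap f) => [[x|]|[x|]] //=; rewrite ?fK ?gK.
move=> /ord_iso_succ[m [mmax tm]].
have ims : ord_iso (ht t) (ht (sval m)).
  apply: ord_iso_trans tm _; case: m mmax => m ms _ /=.
  by apply: ord_iso_sym; exact: (ht_seg (ms : (m < s)%O)).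
have -> : t = sval m by apply: (@ht_inj s) ims; apply: ltW => //; exact: seg_lt.
by split=> [|z zs]; [exact: (seg_lt m)|exact: (mmax (seg_elt zs))].
Qed.

Lemma is_succ_covers s : is_succ (ht s) <-> exists t, covers t s.
Proof.
split=> [[b /ord_iso_succ[m [mmax _]]]|[t /covers_ht[ts ?]]]; last by exists (ht t).
exists (sval m); split=> [|z zs]; [exact: (seg_lt m)|exact: (mmax (seg_elt zs))].
Qed.

Lemma bigP t : big t <-> inhabited (ht t) /\ countably_bounded (ht t).
Proof.
split=> [[[y yt] bt]|[[y0] bt]].
  split=> [|f]; first by apply: inhabits; exact: (seg_elt yt).
  have [n|z zt fz] := bt (fun n => sval (f n)); first exact: (seg_lt (f n)).
  by exists (seg_elt zt) => n; rewrite ht_seg_lt.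
split=> [|y yt]; first by exists (sval y0); exact: (seg_lt y0).
have [z zub] := bt (fun n => seg_elt (yt n)).
exists (sval z) => [|n]; first exact: (seg_lt z).
by have := zub n; rewrite ht_seg_lt.
Qed.

Lemma Rset_big t : Rset T t -> big t.
Proof.
move=> [] + _; rewrite /cf; case: pselect => /= _.
  move=> /ord_iso_sym[f _ _]; exfalso; apply: omega1_uncountable.
  by apply: (@countable_setT _ (fun=> 0)) => x; case: (f x).
by move=> /cof_countably_bounded /bigP.
Qed.

(** Smallness of the height excludes cofinalities above omega_1, which [big] allows. *)
Lemma big_Rset t : small (ht t) -> big t -> ims t !=set0 -> Rset T t.
Proof.
move=> sm bt it; split=> //; rewrite /cf; case: pselect => /= [/is_succ_covers[s]|_].
  by move=> /limit_ncovers /(_ (big_limit bt)).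
by have /bigP[[x0] cb] := bt; exact: cof_omega1.
Qed.

(** * Neighbourhoods in the coarse wedge topology *)

Definition node s := (forall y, ~~ (y < s)%O) \/ exists t, covers t s.

Lemma nodeP s : node s <-> minimal <=%O s \/ is_succ (ht s).
Proof.
rewrite /node -is_succ_covers; split=> -[ms|]; try by right.
  by left=> y; rewrite le_eqVlt (negbTE (ms y)) orbF => /eqP ->.
by left=> y; apply/negP => ys; have := ms y (ltW ys); rewrite (lt_geF ys).
Qed.

Lemma node_between t x : (t < x)%O -> exists2 s, node s & (t < s)%O && (s <= x)%O.
Proof.
move=> tx; have [s cts sx] := covers_ex tx; exists s; first by right; exists t.
by rewrite sx andbT; case: cts.
Qed.

Lemma limit_nnode x : limit x -> ~ node x.
Proof.
move=> lx [mx|[t /limit_ncovers]//]; by case: lx => -[y] /idP; rewrite (negbTE (mx y)).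
Qed.

Lemma nodeVlimit x : node x \/ limit x.
Proof. by case: (limitVcovers x) => ?; [left; left|left; right|right]. Qed.

Lemma subbase_open (B : set (coarse_wedge T)) : coarse_subbase T B -> open B.
Proof.
move=> sB; exists [set B]; last by rewrite bigcup_set1.
by move=> _ ->; exact: finI_from1.
Qed.

Lemma open_wedge s : node s -> open (wedge s : set (coarse_wedge T)).
Proof. by move=> /nodeP ns; apply: subbase_open; exists s => //; left. Qed.

Lemma closed_wedge s : node s -> closed (wedge s : set (coarse_wedge T)).
Proof.
move=> /nodeP ns; rewrite -openC; apply: subbase_open; exists s => //; by right.
Qed.

Lemma nbhs_subbase (F : set_system (coarse_wedge T)) (x : coarse_wedge T) :
  Filter F -> (forall s, node s -> (s <= x)%O -> F (wedge s)) ->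
  (forall s, node s -> ~~ (s <= x)%O -> F (~` wedge s)) -> F --> x.
Proof.
move=> FF Fp Fn U; rewrite nbhsE => -[V [[D sD <-]] [B DB Bx] VU].
have [E sE defB] := sD _ DB.
apply: (@filterS _ _ _ B) => [y By|]; first by apply: VU; exists B.
rewrite -defB; apply: filter_bigI => i Ei.
have [s /nodeP ns] : coarse_subbase T i by apply: set_mem; exact: sE.
have : i x by move: Bx; rewrite -defB; apply.
by move=> ix [] ei; rewrite ei in ix *; [exact: Fp|apply: Fn => //; exact/negP].
Qed.

Section LimitNeighbourhoods.
Hypothesis chainT : chain_complete T.

(** The supersets of the sets described here, wedges starting below [x] minus finitely many wedges
    of immediate successors of [x], form a filter [G]. It contains every subbasic neighbourhood of
    [x], hence every neighbourhood. *)
Lemma nbhs_limit (x : coarse_wedge T) (U : set (coarse_wedge T)) :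
  limit x -> nbhs x U -> exists2 y, (y < x)%O &
    exists2 F : set T, finite_set F /\ F `<=` covers x &
      forall z, (y <= z)%O -> (forall s, F s -> ~~ (s <= z)%O) -> U z.
Proof.
move=> lx; pose G : set_system (coarse_wedge T) := [set U | exists2 y, (y < x)%O &
    exists2 F : set T, finite_set F /\ F `<=` covers x &
      forall z, (y <= z)%O -> (forall s, F s -> ~~ (s <= z)%O) -> U z].
have FG : Filter G.
  split.
  - by have [[y yx] _] := lx; exists y => //; exists set0.
  - move=> P Q [y yx [F [finF sF] FP]] [y' y'x [F' [finF' sF'] FQ]].
    have [v [yv y'v] vx] : exists2 v, (y <= v)%O /\ (y' <= v)%O & (v < x)%O.
      by case/orP: (tree_total (ltW yx) (ltW y'x)) => ?; [exists y'|exists y].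
    exists v => //; exists (F `|` F').
      by split=> [|s []]; [rewrite finite_setU|exact: sF|exact: sF'].
    move=> z vz Fz; split.
      by apply: FP => [|s Fs]; [exact: le_trans vz|apply: Fz; left].
    by apply: FQ => [|s Fs]; [exact: le_trans vz|apply: Fz; right].
  - move=> P Q PQ [y yx [F sF FP]]; exists y => //; exists F => // z yz Fz.
    by apply: PQ; exact: FP.
apply: (nbhs_subbase (F := G)) => s ns.
  rewrite le_eqVlt => /predU1P[sx|sx]; first by case: (limit_nnode lx); rewrite -sx.
  by exists s => //; exists set0.
(* If [x < s], removing one immediate successor of [x] avoids the wedge of [s]; otherwise it
   suffices to start at a [y < x] that is not below [s]. *)
move=> nsx; have [xs|nxs] := boolP (x <= s)%O.
  have [|u cu us] := @covers_ex x s; first by rewrite lt_neqAle xs andbT; apply: contra nsx => /eqP ->.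
  have [[y yx] _] := lx; exists y => //; exists [set u].
    by split=> [|_ ->//]; exact: finite_set1.
  move=> z _ /(_ u erefl) nuz sz; move/negP: nuz; apply.
  exact: le_trans sz.
have [y yx nys] := limit_split chainT lx nxs.
exists y => //; exists set0 => // z yz _ sz.
have /orP[] := tree_total yz sz; first exact/negP.
by move=> sy; move/negP: nsx; apply; exact: le_trans (ltW yx).
Qed.

(** Nodes are cofinal below a limit point and lie in none of the removed wedges. This makes the set
    of nodes dense. *)
Lemma limit_meets (x : coarse_wedge T) (U : set (coarse_wedge T)) y :
  limit x -> nbhs x U -> (y < x)%O -> exists2 s, node s /\ U s & (y < s)%O && (s < x)%O.
Proof.
move=> lx /(nbhs_limit lx)[v vx [F [_ sF] FU]] yx.
have [w [yw vw] wx] : exists2 w, (y <= w)%O /\ (v <= w)%O & (w < x)%O.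
  by case/orP: (tree_total (ltW yx) (ltW vx)) => ?; [exists v|exists y].
have [z wz zx] := lx.2 _ wx.
have [s ns /andP[ws sz]] := node_between wz.
have sx := le_lt_trans sz zx.
exists s; last by rewrite (le_lt_trans yw ws).
split=> //; apply: FU => [|u /sF[xu _]]; first exact: le_trans (ltW ws).
by apply/negP => us; have := lt_trans (lt_le_trans xu us) sx; rewrite ltxx.
Qed.

End LimitNeighbourhoods.

End Tree.

(** * Necessity *)

Lemma inj_card_le_setT (X Y : Type) (f : X -> Y) :
  injective f -> ([set: X] #<= [set: Y])%card.
Proof.
move=> finj; have /card_eqPle[_ fX] := inj_card_eq (in2W finj : {in setT &, injective f}).
by apply: card_le_trans fX _; exact: card_leT.
Qed.

Lemma relatively_discreteP (X : topologicalType) (D : set X) :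
  (forall t, D t -> exists2 U, open U /\ U t & forall t', D t' -> U t' -> t' = t) ->
  relatively_discrete D.
Proof.
move=> H; have H' (t : set_type D) : exists U : set X,
    [/\ open U, U (set_val t) & forall t', D t' -> U t' -> t' = set_val t].
  by have [U [oU Ut] Ueq] := H _ (set_mem (valP t)); exists U.
have [U PU] := choice H' => B; exists (\bigcup_(t in B) U t).
  by apply: bigcup_open => t _; case: (PU t).
apply/seteqP; split=> [u [t Bt Utu]|t Bt].
  suff -> : u = t by [].
  by apply: val_inj; case: (PU t) => _ _; apply => //; exact: (set_mem (valP u)).
by exists t => //; case: (PU t).
Qed.

Lemma big_countable (d : Order.disp_t) (T : treeType d) (I : Type) (x : T)
    (E : set I) (f : I -> T) :
  big x -> countable E -> (forall i, E i -> (f i < x)%O) ->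
  exists2 z, (z < x)%O & forall i, E i -> (f i < z)%O.
Proof.
move=> [[y yx] bx] cE fx; have [E0|nE0] := pselect (E !=set0); last first.
  by exists y => // i Ei; case: nE0; exists i.
have [g [Eg gE]] := countable_enum cE E0.
have [n|z zx gz] := bx (f \o g); first exact: fx.
by exists z => // i /gE[n <-]; exact: gz.
Qed.

Lemma seq_lt_sup (d : Order.disp_t) (T : treeType d) (y : nat -> T) :
  chain_complete T -> (forall n, (y n < y n.+1)%O) -> exists2 x, limit x &
  [/\ forall n, (y n < x)%O, forall z, (z < x)%O -> exists n, (z < y n)%O &
      forall u, (forall n, (y n <= u)%O) -> (x <= u)%O].
Proof.
move=> chainT yS.
have ymono : {homo y : m n / (m <= n)%N >-> (m <= n)%O}.
  by apply: homo_leq => //; [exact: le_trans|move=> n; exact: ltW].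
have [|x [xub xlub]] := chainT (range y).
  by move=> _ _ [m _ <-] [n _ <-]; case/orP: (leq_total m n) => /ymono; [left|right].
have yx n : (y n < x)%O.
  by apply: lt_le_trans (yS n) _; apply: xub; exists n.+1.
have xy z : (z < x)%O -> exists n, (z < y n)%O.
  move=> zx; apply: contrapT => nex; suff : (x <= z)%O by rewrite (lt_geF zx).
  apply: xlub => _ [n _ <-]; apply/negPn/negP => nyz; apply: nex; exists n.
  exact: tree_ltNge (ltW (yx n)) (ltW zx) nyz.
exists x; split=> //.
- by exists (y 0).
- by move=> z /xy[n zn]; exists (y n).
- by move=> u yu; apply: xlub => _ [n _ <-].
Qed.

(** * Points of countable support *)

Section Valdivia.
Context {R : realType} {d : Order.disp_t} {T : treeType d} {Gamma : Type}.
Hypothesis chainT : chain_complete T.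
Variable h : T -> Gamma -> R.
Hypothesis hinj : injective h.
Hypothesis hcont : forall g (x : coarse_wedge T) (e : R), (0 < e)%R ->
  nbhs x [set z : coarse_wedge T | (`|h x g - h z g| < e)%R].
Let supp x : set Gamma := [set g | h x g <> 0%R].
Let A : set T := [set x | countable (supp x)].
Hypothesis hdense : forall U : set (coarse_wedge T), open U -> U !=set0 ->
  exists2 a, U a & A a.
Implicit Types s t x y z u v : T.

Lemma supp_nbhs x g : supp x g -> nbhs (x : coarse_wedge T) [set z | supp z g].
Proof.
move=> /eqP gx; have := @hcont g x `|h x g|%R.
rewrite normr_gt0 => /(_ gx); apply: filterS => z /= + gz.
by rewrite gz subr0 ltxx.
Qed.

(** A coordinate nonzero at [x] is nonzero near [x], so the support of [x] lies in the union of the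
    supports of the [a n]. *)
Lemma closure_A (a : nat -> T) x : (forall n, A (a n)) ->
  (forall U : set (coarse_wedge T), nbhs (x : coarse_wedge T) U -> exists n, U (a n)) -> A x.
Proof.
move=> Aa ax; apply: (@sub_countable _ _ _ (\bigcup_n supp (a n))).
  by apply: subset_card_le => g /supp_nbhs/ax[n ?]; exists n.
apply: bigcup_countable => [|n _]; [exact: countableP|exact: Aa].
Qed.

(* Choose a point of [A] in each of the clopen sets between consecutive terms. *)
Lemma seq_sup_A (y : nat -> T) x : (forall n, (y n < y n.+1)%O) -> limit x ->
  (forall n, (y n < x)%O) -> (forall z, (z < x)%O -> exists n, (z < y n)%O) -> A x.
Proof.
move=> yS lx yx xy.
have /choice[s sP] n : exists s, node s /\ (y n < s)%O && (s <= y n.+1)%O.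
  by have [s ns ys] := node_between (yS n); exists s.
have /choice[a aP] n : exists a, A a /\ (s n <= a)%O /\ ~~ (s n.+1 <= a)%O.
  have [ns /andP[ys sy]] := sP n; have [ns' /andP[ys' sy']] := sP n.+1.
  have [||a [sa /negP nsa] Aa] := @hdense (wedge (s n) `&` ~` wedge (s n.+1)).
  - apply: openI; first exact: open_wedge.
    by apply: closed_openC; exact: closed_wedge.
  - exists (s n); split; rewrite /wedge /= ?lexx//.
    by rewrite (lt_geF (le_lt_trans sy ys')).
  - by exists a.
apply: (@closure_A a) => [n|U /(nbhs_limit chainT lx)[v vx [F [_ sF] FU]]].
  by case: (aP n).
have [n vy] := xy v vx; exists n; have [_ [sa nsa]] := aP n.
have [_ /andP[ys sy]] := sP n.
apply: FU => [|u /sF[xu _]]; first exact: le_trans (ltW vy) (le_trans (ltW ys) sa).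
apply: contra nsa => ua; apply: le_trans ua; apply: ltW; apply: le_lt_trans xu.
have [_ /andP[_ sy']] := sP n.+1; exact: le_trans sy' (ltW (yx _)).
Qed.

(** Countable closing-off: bigness of [x] keeps the supremum of the iterates strictly below [x], and
    [seq_sup_A] puts it in [A]. *)
Lemma iter_lt_sup (f : T -> T) x y : big x -> (y < x)%O ->
  (forall z, (z < x)%O -> (z < f z)%O && (f z < x)%O) ->
  exists2 z, (z < x)%O /\ limit z & A z /\
   [/\ forall n, (iter n f y < x)%O, forall n, (iter n f y < z)%O &
    forall u, (u < z)%O -> exists n, (u < iter n f y)%O].
Proof.
move=> bx yx fP.
have yn n : (iter n f y < x)%O by elim: n => //= n IH; case/andP: (fP _ IH).
have ynS n : (iter n f y < iter n.+1 f y)%O by case/andP: (fP _ (yn n)).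
have [z lz [yz zy zlub]] := seq_lt_sup chainT ynS.
exists z; last by split=> //; exact: seq_sup_A zy.
by have [w wx yw] := bx.2 _ yn; split=> //; apply: le_lt_trans wx; apply: zlub => n; exact: ltW.
Qed.

Lemma A_between x y : big x -> (y < x)%O -> exists2 z, A z & (y < z)%O && (z < x)%O.
Proof.
move=> bx yx.
have /choice[f fP] z : exists w, (z < x)%O -> (z < w)%O && (w < x)%O.
  have [zx|] := boolP (z < x)%O; last by exists z.
  by have [w zw wx] := (big_limit bx).2 z zx; exists w; rewrite zw.
have [z [zx _] [Az [_ yz _]]] := iter_lt_sup bx yx fP.
by exists z => //; rewrite zx andbT; exact: (yz 0).
Qed.

Lemma nbhs_below x (U : set (coarse_wedge T)) : limit x ->
  nbhs (x : coarse_wedge T) U ->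
  exists2 y, (y < x)%O & forall z, (y <= z)%O -> (z <= x)%O -> U z.
Proof.
move=> lx /(nbhs_limit chainT lx)[y yx [F [_ sF] FU]]; exists y => // z yz zx.
by apply: FU => // s /sF[xs _]; rewrite (lt_geF (le_lt_trans zx xs)).
Qed.

(** For each n the coordinate stays within 1/(n+1) of its value at [x] on some segment ending at
    [x]; bigness gives one segment that works for all n. *)
Lemma big_const x g : big x ->
  exists2 y, (y < x)%O & forall z, (y <= z)%O -> (z <= x)%O -> h z g = h x g.
Proof.
move=> bx.
have /choice[y yP] n : exists y, (y < x)%O /\
    forall z, (y <= z)%O -> (z <= x)%O -> (`|h x g - h z g| < n.+1%:R^-1)%R.
  have [|y yx yz] := @nbhs_below x _ (big_limit bx) (@hcont g x n.+1%:R^-1%R _).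
    by rewrite invr_gt0 ltr0n.
  by exists y.
have [|z zx yz] := bx.2 y; first by move=> n; case: (yP n).
exists z => // w zw wx; apply/eqP; rewrite eq_sym -subr_eq0 -normr_eq0.
apply/negPn/negP => gt0.
have {}gt0 : (0 < `|h x g - h w g|)%R by rewrite lt_def gt0 normr_ge0.
pose N := Num.truncn (`|h x g - h w g|^-1)%R.
have lt_N : (N.+1%:R^-1 < `|h x g - h w g|)%R.
  by rewrite -ltf_pV2 ?posrE ?invr_gt0 ?ltr0n// invrK truncnS_gt.
have := (yP N).2 w (le_trans (ltW (yz N)) zw) wx.
by move=> /lt_trans /(_ lt_N); rewrite ltxx.
Qed.

Lemma big_const_countable x (E : set Gamma) : big x -> countable E ->
  exists2 y, (y < x)%O &
  forall g, E g -> forall z, (y <= z)%O -> (z <= x)%O -> h z g = h x g.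
Proof.
move=> bx cE.
have /choice[y yP] g : exists y, (y < x)%O /\
    forall z, (y <= z)%O -> (z <= x)%O -> h z g = h x g.
  by have [y yx yz] := big_const g bx; exists y.
have [|z zx yz] := @big_countable _ _ _ x E y bx cE; first by move=> g _; case: (yP g).
exists z => // g Eg w zw; apply: (yP g).2; exact: le_trans (ltW (yz g Eg)) zw.
Qed.

(* Otherwise some [y < x] would have the same image as [x]. *)
Lemma big_notin_A x : big x -> ~ A x.
Proof.
move=> bx Ax.
(* [f z] is a point of [A] above [z] from which, up to [x], all coordinates in the supports of [x]
   and (when [z] is in [A]) of [z] are frozen. *)
have /choice[f fP] z : exists w, (z < x)%O -> [/\ (z < w)%O && (w < x)%O, A w &
    A z -> forall g, supp z g \/ supp x g ->
      forall u, (w <= u)%O -> (u <= x)%O -> h u g = h x g].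
  have [zx|] := boolP (z < x)%O; last by exists z.
  have [v vx vP] : exists2 v, (v < x)%O & A z -> forall g, supp z g \/ supp x g ->
      forall u, (v <= u)%O -> (u <= x)%O -> h u g = h x g.
    have [Az|nAz] := pselect (A z); last by exists z.
    have [v vx vP] := big_const_countable bx (countable_setU Az Ax).
    by exists v.
  have [w [zw vw] wx] : exists2 w, (z <= w)%O /\ (v <= w)%O & (w < x)%O.
    by case/orP: (tree_total (ltW zx) (ltW vx)) => ?; [exists v|exists z].
  have [u Au /andP[wu ux]] := A_between bx wx.
  exists u => _; split=> //; first by rewrite (le_lt_trans zw wu).
  by move=> Az g gzx t ut; apply: vP => //; exact: le_trans (ltW (le_lt_trans vw wu)) ut.
have [[y0 y0x] _] := bx; have [y Ay /andP[_ yx]] := A_between bx y0x.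
have fP' z : (z < x)%O -> (z < f z)%O && (f z < x)%O by move=> /fP[].
have [z [zx lz] [_ [yn ynz zyn]]] := iter_lt_sup bx yx fP'.
have Ayn n : A (iter n f y) by case: n => //= n; case: (fP _ (yn n)).
suff : z = x by move=> zx'; rewrite zx' ltxx in zx.
apply: hinj; apply/funext => g.
have zP n g' : supp (iter n f y) g' \/ supp x g' -> h z g' = h x g'.
  have [_ _ /(_ (Ayn n) g')] := fP _ (yn n) => + gn => /(_ gn); apply; last exact: ltW.
  exact: ltW (ynz n.+1).
have [[n gn]|nn] := pselect (exists n, supp (iter n f y) g \/ supp x g); first exact: zP gn.
have -> : h x g = 0%R by apply: contrapT => xg; apply: nn; exists 0; right.
(* A coordinate outside all these supports vanishes at [z], since otherwise it would be nonzero at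
   some iterate below [z]. *)
apply: contrapT => /supp_nbhs /(nbhs_below lz)[v vz vP].
have [n vyn] := zyn _ vz; apply: nn; exists n; left.
by apply: vP; exact: ltW.
Qed.

(** A neighbourhood of [t] contains the wedges of all but finitely many immediate successors, so
    points of [A] above infinitely many of them would put [t] in [A]. *)
Lemma Rset_covers_finite t : Rset T t -> finite_set (ims t).
Proof.
move=> Rt; apply: contrapT => /infiniteP /card_leP[f].
have bt := Rset_big Rt.
pose s n := sval (f (SigSub (mem_set (I : [set: nat] n)))).
have sinj : injective s.
  by move=> m n /val_inj /(inj (f := f) (mem_set I) (mem_set I)) [].
have st n : covers t (s n).
  by apply/covers_ht; exact: set_mem (valP (f (SigSub (mem_set (I : [set: nat] n))))).
have /choice[a aP] n : exists a, A a /\ (s n <= a)%O.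
  have [||a sa Aa] := @hdense (wedge (s n)); last by exists a.
    by apply: open_wedge; right; exists t.
  by exists (s n); rewrite /wedge /= lexx.
apply: (big_notin_A bt); apply: (@closure_A a) => [n|U]; first by case: (aP n).
move=> /(nbhs_limit chainT (big_limit bt))[y yt [F [finF sF] FU]].
have [n nF] : exists n, ~ F (s n).
  apply: contrapT => nex; apply: infinite_nat.
  apply: (@sub_finite_set _ _ (s @^-1` F)).
    by move=> n _; apply: contrapT => ?; apply: nex; exists n.
  by apply: finite_preimage => // m n _ _; exact: sinj.
exists n; have [_ sa] := aP n; apply: FU => [|u Fu].
  by apply: le_trans (ltW yt) (le_trans (ltW (st n).1) sa).
apply/negP => ua; apply: nF; suff -> : s n = u by [].
have [tu _] := sF _ Fu; have [ts _] := st n.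
by case/orP: (tree_total ua sa) => [us|su]; [rewrite (covers_le (st n) tu us)|
  exact: (covers_le (sF _ Fu) ts su)].
Qed.

(* A non-isolated [t] would be a limit of points [a t'], where [h _ g] vanishes. *)
Lemma supp_isolated (E : set T) (a : T -> T) g (al : ordtype) :
  (forall t, E t -> [/\ ord_iso (ht t) al, limit t, (t < a t)%O, h t g <> 0%R & h (a t) g = 0%R]) ->
  forall t, E t -> exists2 v, (v < t)%O & forall t', E t' -> (v <= t')%O -> t' = t.
Proof.
move=> EP t Et; have [ht_t lt _ gt _] := EP _ Et.
have [v vt [F [_ sF] FU]] := nbhs_limit chainT lt (supp_nbhs gt).
exists v => // t' Et' vt'; have [ht_t' _ ta' _ ga'] := EP _ Et'.
have hiso : ord_iso (ht t') (ht t) := ord_iso_trans ht_t' (ord_iso_sym ht_t).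
apply: contrapT => ne; suff : supp (a t') g by [].
apply: FU => [|s Fs]; first exact: le_trans (ltW ta').
(* If [s <= t'] then [t'] is higher than [t]; otherwise [t' < s], so [t' <= t] and equal heights
   give [t' = t]. *)
apply/negP => sa; have [ts cts] := sF _ Fs.
have [st'|nst'] := boolP (s <= t')%O.
  by apply: (ord_lt_not_le (ht_lt (lt_le_trans ts st'))); right.
have t't := cts _ (tree_ltNge sa (ltW ta') nst').
by apply: ne; apply: (ht_inj t't (lexx t)).
Qed.

(** The class index encodes the height of [x] and the number of [g] in the support of [x]. In the
    wedge of a node between [x] and [t], points of the same class share [x], hence [g], and
    [supp_isolated] separates them. *)
Lemma Rset_discrete (al : ordtype) : ord_lt al (omega 2) ->
  omega1_relatively_discrete (Rset T `&` Lev T al : set (coarse_wedge T)).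
Proof.
move=> al2.
have [k kinj] := small_prod (small_lt_omega2 al2) small_nat.
have /choice[num numP] x : exists f : Gamma -> nat, A x ->
    forall g g', supp x g -> supp x g' -> f g = f g' -> g = g'.
  have [Ax|nAx] := pselect (A x); last by exists (fun=> 0).
  have /countable_injP[f finj] := Ax; exists f => _ g g' sg sg'.
  by apply: finj; rewrite inE.
(* [q t = (a, x, g)] with [g] in the support of [t] and of [x < t], not of [a > t]. *)
have /choice[q qP] t : exists q : T * T * option Gamma, Rset T t ->
    exists2 g, q.2 = Some g & [/\ (t < q.1.1)%O /\ h q.1.1 g = 0%R,
      (q.1.2 < t)%O, A q.1.2, supp q.1.2 g & supp t g].
  have [Rt|nRt] := pselect (Rset T t); last by exists (t, t, None).
  have bt := Rset_big Rt; have [_ [s /covers_ht cts]] := Rt.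
  have [||a sa Aa] := @hdense (wedge s).
  - by apply: open_wedge; right; exists t.
  - by exists s; rewrite /wedge /= lexx.
  (* The support of [a] is countable, that of [t] is not. *)
  have [g tg ag] : exists2 g, supp t g & ~ supp a g.
    apply: contrapT => nex; apply: (big_notin_A bt); apply: sub_countable Aa.
    by apply: subset_card_le => g tg; apply: contrapT => ?; apply: nex; exists g.
  have [v vt vP] := nbhs_below (big_limit bt) (supp_nbhs tg).
  have [x Ax /andP[vx xt]] := A_between bt vt.
  exists (a, x, Some g) => _; exists g; split=> //=.
  - by split; [exact: lt_le_trans cts.1 sa|exact: contrapT].
  - by apply: vP; exact: ltW.
pose D i : set (coarse_wedge T) := [set t | [/\ Rset T t, Lev T al t &
  exists (c : al) n g, [/\ k (c, n) = i, ord_iso (ht (q t).1.2) (oseg c),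
    (q t).2 = Some g & num (q t).1.2 g = n]]].
exists D => [i|]; last first.
  apply/seteqP; split=> [t [Rt Lt]|t [i _ [Rt Lt _]]]; last by [].
  have [g qg [_ xt Ax _ _]] := qP t Rt.
  have [c xc] : exists c : al, ord_iso (ht (q t).1.2) (oseg c).
    by have [c] := ord_lt_le_trans (ht_lt xt) (or_intror Lt); exists c.
  by exists (k (c, num (q t).1.2 g)) => //; split=> //; exists c, (num (q t).1.2 g), g.
apply: relatively_discreteP => t [Rt Lt [c [n [g [kcn xc qg ng]]]]].
have [g' qg' [[ta ag] xt Ax xg tg]] := qP t Rt.
move: qg'; rewrite qg => -[gg']; subst g'.
pose E : set T := [set t | [/\ Rset T t, Lev T al t & (q t).2 = Some g]].
have [||v vt vE] := @supp_isolated E (fun t => (q t).1.1) g al _ t.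
- move=> u [Ru Lu qu]; have [gu] := qP u Ru; rewrite qu => -[<-] [[ua uag] _ _ _ ug].
  by split=> //; apply: big_limit; exact: Rset_big.
- by [].
have [w [xw vw] wt] : exists2 w, ((q t).1.2 <= w)%O /\ (v <= w)%O & (w < t)%O.
  by case/orP: (tree_total (ltW xt) (ltW vt)) => ?; [exists v|exists (q t).1.2].
have [s ns /andP[ws st]] := node_between wt.
exists (wedge s) => [|u [Ru Lu [c' [n' [g' [/esym kcn' xc' qg' ng']]]]] su].
  by split=> //; exact: open_wedge.
have [c'c n'n] : c' = c /\ n' = n by move: kcn'; rewrite -kcn => /kinj[-> ->].
have [g'' qg'' [_ xu _ xg'' _]] := qP u Ru.
have {qg''} g''g' : g'' = g' by move: qg''; rewrite qg' => -[].
have xx : (q u).1.2 = (q t).1.2.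
  apply: (@ht_inj _ _ u); first exact: ltW.
    exact: le_trans xw (le_trans (ltW ws) su).
  by rewrite c'c in xc'; exact: ord_iso_trans xc' (ord_iso_sym xc).
have g'g : g' = g.
  apply: (numP _ Ax) => //; first by rewrite -xx -g''g'.
  by rewrite ng -n'n -ng' xx.
apply: vE; first by split=> //; rewrite qg' g'g.
exact: le_trans vw (le_trans (ltW ws) su).
Qed.

Lemma omega1_lt (y : nat -> omega 1) : exists i, forall n, lto (y n) i.
Proof.
apply: contrapT => nex; apply: omega1_uncountable.
apply: (@sub_countable _ _ _ (\bigcup_n [set j | leo j (y n)])).
  apply: subset_card_le => i _; apply: contrapT => ni; apply: nex; exists i => n.
  by apply/negP => iy; apply: ni; exists n.
by apply: bigcup_countable => [|n _]; [exact: countableP|exact: omega1_seg_countable_le].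
Qed.

(* [t] cannot have cofinality greater than [omega 1]: a strictly increasing
   sequence of length [omega 1] that absorbs supports has a supremum [z < t] all
   of whose support persists up to [t], in particular at some [y > z] in [A]. *)
Lemma bounded_omega1_false t : big t ->
  ~ (forall f : omega 1 -> T, (forall i, (f i < t)%O) -> exists2 z, (z < t)%O & forall i, (f i <= z)%O).
Proof.
move=> bt ub.
have /choice[y yP] g : exists y, (y < t)%O /\
    forall z, (y <= z)%O -> (z <= t)%O -> h z g = h t g.
  by have [y yx yz] := big_const g bt; exists y.
(* [step E] is a point of [A] above [E] and above the threshold [y g] of every coordinate [g] in the
   support of a point of [E]. *)
have /choice[step stepP] E : exists z, countable E -> (forall e, E e -> (e < t)%O /\ A e) ->
    [/\ (z < t)%O, A z & forall e, E e -> (e < z)%O /\ forall g, supp e g -> (y g <= z)%O].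
  have [[cE EP]|nE] := pselect (countable E /\ forall e, E e -> (e < t)%O /\ A e); last first.
    by have [[z _] _] := bt; exists z => ? ?; case: nE.
  have [v vt vE] : exists2 v, (v < t)%O & forall e, E e -> (e < v)%O.
    by apply: (big_countable (f := id)) => // e /EP[].
  have [w wt wE] : exists2 w, (w < t)%O & forall g, (\bigcup_(e in E) supp e) g -> (y g < w)%O.
    apply: big_countable => //; last by move=> g _; case: (yP g).
    by apply: bigcup_countable => // e /EP[].
  have [u [vu wu] ut] : exists2 u, (v <= u)%O /\ (w <= u)%O & (u < t)%O.
    by case/orP: (tree_total (ltW vt) (ltW wt)) => ?; [exists w|exists v].
  have [z Az /andP[uz zt]] := A_between bt ut.
  exists z => _ _; split=> // e Ee; split=> [|g eg].
    exact: lt_trans (lt_le_trans (vE _ Ee) vu) uz.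
  by apply: ltW (lt_trans (lt_le_trans (wE _ _) wu) uz); exists e.
have [e eE] := ord_recursion (omega 1) step.
have cE i : countable [set e j | j in [set j | lto j i]].
  by apply: sub_countable (card_image_le _ _) _; exact: omega1_seg_countable.
have eP i : (e i < t)%O /\ A (e i).
  elim/below_ord: i => i IH; rewrite eE.
  by have [|//] := stepP _ (cE i); move=> _ [j ji <-]; exact: IH.
have eS i j : lto j i -> (e j < e i)%O /\ forall g, supp (e j) g -> (y g <= e i)%O.
  move=> ji; rewrite (eE i); have [|_ _] := stepP _ (cE i); last by apply; exists j.
  by move=> _ [j' _ <-].
have [z0 z0t ez0] := ub e (fun i => (eP i).1).
have [|z [zub zlub]] := @chainT (range e).
  by move=> _ _ [i _ <-] [j _ <-]; apply/orP; apply: (@tree_total _ _ t); apply: ltW; [case: (eP i)|case: (eP j)].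
have zt : (z < t)%O by apply: le_lt_trans z0t; apply: zlub => _ [i _ <-].
have ez i : (e i < z)%O.
  have [j ij] := omega1_lt (fun=> i).
  by apply: lt_le_trans (eS _ _ (ij 0)).1 _; apply: zub; exists j.
have ze u : (u < z)%O -> exists i, (u < e i)%O.
  move=> uz; apply: contrapT => nex; suff : (z <= u)%O by rewrite (lt_geF uz).
  apply: zlub => _ [i _ <-]; apply/negPn/negP => neu; apply: nex; exists i.
  exact: tree_ltNge (ltW (ez i)) (ltW uz) neu.
(* Countably many indices are bounded in omega_1, so [z] has uncountable cofinality and cannot lie
   in [A]. *)
have bz : big z.
  split=> [|u uz]; first by have [i] := omega1_inhabited; exists (e i).
  have /choice[i ui] n := ze _ (uz n); have [j ij] := omega1_lt i.
  by exists (e j) => // n; exact: lt_trans (ui n) (eS _ _ (ij n)).1.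
have [x Ax /andP[zx xt]] := A_between bt zt.
(* A coordinate nonzero at [z] is nonzero at some [e i]; its threshold is then at most [z], so its
   value persists up to [x]. *)
apply: (big_notin_A bz); apply: sub_countable Ax; apply: subset_card_le => g zg.
have [v vz vP] := nbhs_below (big_limit bz) (supp_nbhs zg).
have [i vi] := ze _ vz; have eg : supp (e i) g by apply: vP; exact: ltW.
have [j ij] := omega1_lt (fun=> i).
have yz : (y g <= z)%O := le_trans ((eS _ _ (ij 0)).2 _ eg) (ltW (ez j)).
have [_ yg] := yP g; rewrite /supp /= (yg x _ (ltW xt)); last exact: le_trans (ltW zx).
by rewrite -(yg z yz (ltW zt)).
Qed.

End Valdivia.

(** * Regularity of omega_2 and the necessary conditions *)

Lemma small_seg (d : Order.disp_t) (T : treeType d) (y : T) : small (ht y) ->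
  exists c : T -> omega 1, forall z z', (z < y)%O -> (z' < y)%O -> c z = c z' -> z = z'.
Proof.
have [o] := omega1_inhabited; move=> [f finj].
exists (fun z => if pselect (z < y)%O is left zy then f (seg_elt zy) else o) => z z' zy z'y.
by case: pselect => // zy1; case: pselect => // zy2 /finj[].
Qed.

(** If there were no bound, the predecessors of [t] would be covered by omega_1 many segments of
    size at most omega_1. *)
Lemma omega2_bounded (d : Order.disp_t) (T : treeType d) (t : T) (X : Type) (f : X -> T) :
  ord_iso (ht t) (omega 2) -> small X -> (forall x, (f x < t)%O) ->
  exists2 z, (z < t)%O & forall x, (f x < z)%O.
Proof.
move=> t2 sX ft; apply: contrapT => nb.
have /choice[c cinj] (x : X) : exists c : T -> omega 1,
    forall z z', (z < f x)%O -> (z' < f x)%O -> c z = c z' -> z = z'.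
  apply: small_seg; apply: small_lt_omega2.
  exact: ord_lt_le_trans (ht_lt (ft x)) (or_intror t2).
have /choice[g gP] (z : ht t) : exists x, (sval z <= f x)%O.
  apply: contrapT => nx; apply: nb; exists (sval z) => [|x]; first exact: seg_lt.
  by apply: tree_ltNge (ltW (seg_lt z)) (ltW (ft x)) _; apply/negP => zx; apply: nx; exists x.
apply: (omegaSP 1).1.
have [k kinj] : small (X * (nat * omega 1)).
  by apply: small_prod => //; apply: small_prod; [exact: small_nat|exists id].
have [p /bij_inj pinj _] := ord_iso_sym t2.
(* The bit marks the end point of the segment, because [c] is injective only strictly below it. *)
pose m z := k (g (p z), (nat_of_bool (sval (p z) == f (g (p z))), c (g (p z)) (sval (p z)))).
apply: (@inj_card_le_setT _ _ m) => u v /kinj [guv + cuv].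
move=> buv; apply: pinj; apply: val_inj; move: buv cuv (gP (p u)) (gP (p v)).
rewrite -guv; case: eqVneq => [eu|nu]; case: eqVneq => [ev|nv] //= _ cuv uf vf.
  by rewrite eu ev.
by apply: cinj cuv; rewrite lt_neqAle ?nu ?nv.
Qed.

Lemma valdivia_sep (R : realType) (d : Order.disp_t) (T : treeType d) :
  valdivia R (coarse_wedge T) -> exists (Gamma : Type) (h : T -> Gamma -> R),
    [/\ injective h,
      forall g (x : coarse_wedge T) (e : R), (0 < e)%R ->
        nbhs x [set z : coarse_wedge T | (`|h x g - h z g| < e)%R] &
      forall U : set (coarse_wedge T), open U -> U !=set0 ->
        exists2 a, U a & countable [set g | h a g <> 0%R]].
Proof.
move=> [_ [A dA [G [h [[hinj hcont _] hA]]]]]; exists G, h; split=> //.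
- move=> g x e e0.
  have : (fun z => h z g) @ (x : coarse_wedge T) --> h x g.
    have pc : continuous (fun f : {ptws G -> R} => f g).
      exact: (@proj_continuous {classic G} (fun=> R) g).
    by apply: (@continuous_comp _ _ _ h (fun f : {ptws G -> R} => f g) x); [exact: hcont|exact: pc].
  by move=> /cvgrPdist_lt /(_ _ e0).
- move=> U oU U0; have [a [Ua Aa]] := dA U U0 oU; exists a => //.
  suff : (range h `&` Sigma R G) (h a) by case.
  by rewrite -hA; exists a.
Qed.

Lemma valdivia_necessary (R : realType) (d : Order.disp_t) (T : treeType d) :
  chain_complete T -> valdivia R (coarse_wedge T) ->
  [/\ Lev T (omega 2) = set0, forall t : T, Rset T t -> finite_set (ims t) &
    forall a : ordtype, ord_lt a (omega 2) ->
      omega1_relatively_discrete (Rset T `&` Lev T a : set (coarse_wedge T))].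
Proof.
move=> chainT /valdivia_sep[G [h [hinj hcont hdense]]]; split.
- rewrite -subset0 => t t2.
  have bt : big t.
    have [i] := omega1_inhabited; have [p _ _] := ord_iso_sym t2.
    split; last by move=> y; exact: omega2_bounded t2 small_nat.
    have [j _] : exists j : omega 2, True; last by exists (sval (p j)); exact: seg_lt.
    apply: contrapT => nj; apply: (omegaSP 1).1.
    by apply: (@inj_card_le_setT _ _ (fun=> i)) => x; case: nj; exists x.
  apply: (bounded_omega1_false chainT hinj hcont hdense bt) => f ft.
  have [|z zt fz] := omega2_bounded t2 _ ft; first by exists id.
  by exists z => // x; exact: ltW.
- by move=> t; exact: (Rset_covers_finite chainT hinj hcont hdense).
- by move=> a; exact: (Rset_discrete chainT hinj hcont hdense).
Qed.

(** * Walks along ladders *)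

Section Walks.
Variables (W : ordtype) (e : W -> omega 1).
Hypothesis einj : injective e.
Implicit Types (x y z c s : W) (al rho xi zeta eta : W).

Definition ocovers x y := lto x y /\ forall z, lto z y -> leo z x.

Definition olimit x := (exists y, lto y x) /\
  forall y, lto y x -> exists2 z, lto y z & lto z x.

Definition obig x := (exists y, lto y x) /\
  forall y : nat -> W, (forall n, lto (y n) x) ->
    exists2 z, lto z x & forall n, lto (y n) z.

Lemma ltoNge x y : lto x y = ~~ leo y x. Proof. by []. Qed.

Lemma leoNgt x y : leo x y = ~~ lto y x. Proof. by rewrite /lto negbK. Qed.

Lemma obig_limit x : obig x -> olimit x.
Proof.
move=> [ex bx]; split=> // y yx; have [//|z zx yz] := bx (fun=> y).
by exists z => //; exact: (yz 0).
Qed.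

Lemma ocovers_nlimit x y : ocovers x y -> ~ olimit y.
Proof. by move=> [xy cxy] [_ /(_ _ xy)[z xz /cxy]]; rewrite leoNgt xz. Qed.

Lemma ocovers_ex x y : lto x y -> exists2 z, ocovers x z & leo z y.
Proof.
move=> xy; have [|z xz zmin] := @leo_min W (lto x); first by exists y.
exists z; last exact: zmin.
by split=> // u uz; rewrite leoNgt; apply/negP => /zmin; rewrite leoNgt uz.
Qed.

Lemma ocovers_inj x y y' : ocovers x y -> ocovers x y' -> y = y'.
Proof.
move=> [xy cy] [xy' cy']; case: (ltoP y y') => // [/cy'|/cy]; rewrite leoNgt ?xy//.
by rewrite xy'.
Qed.

Lemma olimitVcovers x y : lto x y -> olimit y \/ exists z, ocovers z y.
Proof.
move=> xy; have [|ly] := pselect (exists z, ocovers z y); [by right|left].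
split=> [|z zy]; first by exists x.
have [u zu uy] := ocovers_ex zy; case: (leo_eqVlt uy) => [eu|]; last first.
  by exists u => //; case: zu.
by case: ly; exists z; rewrite -eu.
Qed.

(* At a limit, the successors of the records: the last points of the walks of
   [walk_cofinal] must be successors. *)
Definition ladder rho c := ocovers c rho \/
  (olimit rho /\ exists2 r, is_record e [set x | lto x rho] r & ocovers r c).

Lemma ladder_lt rho c : ladder rho c -> lto c rho.
Proof.
move=> [[]//|[lrho [r [rrho _] [rc cr]]]].
have [z rz zrho] := lrho.2 _ rrho; apply: leo_lto_trans zrho.
by rewrite leoNgt; apply/negP => /cr; rewrite leoNgt rz.
Qed.

Lemma ladder_cofinal rho x : lto x rho -> exists2 c, ladder rho c & leo x c.
Proof.
move=> xrho; have [lrho|[c [crho cc]]] := olimitVcovers xrho; last first.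
  by exists c; [left|exact: cc].
have [//|r rr xr] := @record_cofinal W e [set x | lto x rho] x.
have [c rc _] := ocovers_ex rr.1; exists c; first by right; split=> //; exists r.
by apply: leo_trans xr (ltoW _); case: rc.
Qed.

(** At a limit, ladder points up to [x] are successors of records below a fixed record [r0] above
    [x], and these records are countably many. *)
Lemma ladder_countable rho x : lto x rho -> countable [set c | ladder rho c /\ leo c x].
Proof.
move=> xrho; have [lrho|[c0 [crho cc]]] := olimitVcovers xrho; last first.
  apply: sub_countable (countable1 c0); apply: subset_card_le => c [[[crho' cc']|[lrho _]] _].
    by apply: leo_anti; [exact: cc|exact: cc'].
  by case: (ocovers_nlimit (conj crho cc) lrho).
have [//|r0 rr0 xr0] := @record_cofinal W e [set x | lto x rho] x.
apply: (@sub_countable _ _ _ (\bigcup_(r in [set r | is_record e [set x | lto x rho] r /\ leo r r0])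
    [set c | ocovers r c])).
  apply: subset_card_le => c [[/ocovers_nlimit//|[_ [r rr rc]]] cx].
  by exists r => //; split=> //; apply: leo_trans xr0; apply: leo_trans cx; apply: ltoW; case: rc.
apply: bigcup_countable => [|r _]; first exact: record_seg_countable.
have [[c rc]|nc] := pselect (exists c, ocovers r c).
  by apply: sub_countable (countable1 c); apply: subset_card_le => c' rc'; exact: ocovers_inj rc' rc.
by apply: sub_countable (countable0 W); apply: subset_card_le => c rc; case: nc; exists c.
Qed.

Lemma ladder_succ rho c : olimit rho -> ladder rho c -> exists r, ocovers r c.
Proof. by move=> lrho [/ocovers_nlimit//|[_ [r _ rc]]]; exists r. Qed.

(** An unbounded sequence below [rho] would cut the ladder into countably many countable pieces. *)
Lemma ladder_uncountable rho : ~ countable (ladder rho) -> obig rho.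
Proof.
move=> nc; split.
  apply: contrapT => nex; apply: nc; apply: sub_countable (countable0 W).
  by apply: subset_card_le => c /ladder_lt crho; case: nex; exists c.
move=> y yrho; apply: contrapT => nex; apply: nc.
apply: (@sub_countable _ _ _ (\bigcup_n [set c | ladder rho c /\ leo c (y n)])).
  apply: subset_card_le => c lc; apply: contrapT => nc; apply: nex; exists c; first exact: ladder_lt.
  by move=> n; rewrite ltoNge; apply/negP => cy; apply: nc; exists n.
by apply: bigcup_countable => [|n _]; [exact: countableP|exact: ladder_countable].
Qed.

Definition next s rho c :=
  [/\ ladder rho c, leo s c & forall c', ladder rho c' -> leo s c' -> leo c c'].

Lemma next_ex s rho : lto s rho -> exists c, next s rho c.
Proof.
move=> /ladder_cofinal[c lc sc].
have [|m [lm sm] mmin] := @leo_min W (fun c => ladder rho c /\ leo s c); first by exists c.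
by exists m; split=> // c' lc' sc'; exact: mmin.
Qed.

Lemma next_inj s rho c c' : next s rho c -> next s rho c' -> c = c'.
Proof. by move=> [lc sc cm] [lc' sc' cm']; apply: leo_anti; [exact: cm|exact: cm']. Qed.

(* [walk s rho al]: [al] is a point of the minimal walk from [rho] down to [s]
   along the ladders. *)
Inductive walk s : W -> W -> Prop :=
| walk_refl rho : walk s rho rho
| walk_step rho c al : lto s rho -> next s rho c -> walk s c al -> walk s rho al.

Lemma walk_inv s rho al : walk s rho al ->
  al = rho \/ exists c, [/\ lto s rho, next s rho c & walk s c al].
Proof. by case=> [rho'|rho' c al' sr nr w]; [left|right; exists c]. Qed.

Lemma walk_self s al : walk s s al -> al = s.
Proof. by move=> /walk_inv[//|[c []]]; rewrite lto_irr. Qed.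

Lemma walk_ge s rho al : walk s rho al -> leo s rho -> leo s al.
Proof. by elim=> // rho' c al' _ [_ sc _] _ IH _; exact: IH. Qed.

Lemma walk_finite s rho : finite_set (walk s rho).
Proof.
elim/below_ord: rho => rho IH.
have [srho|nsrho] := boolP (lto s rho); last first.
  apply: (@sub_finite_set _ _ [set rho]); last exact: finite_set1.
  by move=> al /walk_inv[//|[c [srho]]]; rewrite srho in nsrho.
have [c nc] := next_ex srho.
apply: (@sub_finite_set _ _ ([set rho] `|` walk s c)).
  move=> al /walk_inv[->|[c' [_ nc' wc']]]; [by left|right].
  by rewrite (next_inj nc nc').
by rewrite finite_setU; split; [exact: finite_set1|apply: IH; case: nc => /ladder_lt].
Qed.

(* Only countably many points of the ladder at [rho] can be the first step of the
   walk: if the ladder is uncountable then [rho] is [obig], and [s] is bounded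
   strictly below [rho], by [g rho] if [rho < zeta] and by [zeta] otherwise. *)
Lemma walk_countable (g : W -> W) zeta rho :
  (forall al, obig al -> lto (g al) al) -> ~ obig zeta ->
  countable [set s | [/\ lto s rho, lto s zeta &
    forall al, walk s rho al -> lto al zeta -> obig al -> lto s (g al)]].
Proof.
move=> greg nbz; elim/below_ord: rho => rho IH.
pose S c := [set s | [/\ lto s c, lto s zeta &
    forall al, walk s c al -> lto al zeta -> obig al -> lto s (g al)]].
suff [K cK KS] : exists2 K : set W, countable K &
    forall s c, S rho s -> next s rho c -> K c.
  (* The set is split by the first step of the walk; each piece is countable by induction. *)
  apply: (@sub_countable _ _ _ (\bigcup_(c in K `&` [set c | lto c rho]) ([set c] `|` S c))).
    apply: subset_card_le => s Ss; have [srho sz sw] := Ss.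
    have [c nc] := next_ex srho; have [lc sc _] := nc.
    exists c; first by split; [exact: KS nc|exact: ladder_lt].
    case: (leo_eqVlt sc) => [->|{}sc]; [by left|right; split=> // al wal].
    by apply: sw; exact: walk_step nc wal.
  apply: bigcup_countable => [|c [_ crho]]; last exact: countable_setU (countable1 _) (IH _ crho).
  by apply: sub_countable cK; apply: subset_card_le => c [].
have [cl|/ladder_uncountable brho] := pselect (countable (ladder rho)).
  by exists (ladder rho) => // s c _ [].
have [b brho' Sb] : exists2 b, lto b rho & forall s, S rho s -> leo s b.
  case: (ltoP rho zeta) => [rz|rz|zr].
  - exists (g rho); first exact: greg.
    by move=> s [_ _ sw]; apply: ltoW; apply: sw => //; exact: walk_refl.
  - by rewrite rz in brho.
  - by exists zeta => // s [_ sz _]; exact: ltoW.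
have [c0 [lc0 bc0 c0min]] := next_ex brho'.
exists [set c | ladder rho c /\ leo c c0].
  exact: ladder_countable (ladder_lt lc0).
move=> s c /Sb sb [lc sc cmin]; split=> //.
by apply: cmin => //; exact: leo_trans bc0.
Qed.

(* If the ladder at [rho] is cofinal in [xi], one of its points will do; otherwise
   the walks to all large [s < xi] go through the first ladder point above [xi]. *)
Lemma walk_cofinal xi rho eta : olimit xi -> leo xi rho -> lto eta xi ->
  exists s, [/\ exists r, ocovers r s, lto eta s, lto s xi &
    forall al, walk s rho al -> lto al xi -> al = s].
Proof.
move=> lxi; elim/below_ord: rho eta => rho IH eta xirho etaxi.
(* A ladder point [c] inside the interval can serve as [s], for the walk to [c] arrives there in one
   step. *)
have direct (c : W) : ladder rho c -> (exists r, ocovers r c) -> lto eta c -> lto c xi ->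
    exists s, [/\ exists r, ocovers r s, lto eta s, lto s xi &
    forall al, walk s rho al -> lto al xi -> al = s].
  move=> lc rc etac cxi; exists c; split=> // al /walk_inv[->|[c' [_ [lc' cc' cmin] wc']]].
    by rewrite ltoNge xirho.
  move=> _; have := cmin _ lc (leo_refl _) => c'c.
  by rewrite (leo_anti c'c cc') in wc'; exact: walk_self.
(* Cofinality yields only [leo eta' c]; inserting [eta'] makes [c] strictly above [eta]. *)
have [eta' ee' e'xi] := lxi.2 _ etaxi.
case: (leo_eqVlt xirho) => [exi|{}xirho].
  have [c lc e'c] := ladder_cofinal (lto_le_trans e'xi xirho).
  apply: (direct c) => //; first by apply: ladder_succ lc; rewrite -exi.
    exact: lto_le_trans e'c.
  by rewrite exi; exact: ladder_lt.
have [cof|] := pselect (forall eta', lto eta' xi -> exists2 c, ladder rho c & leo eta' c && lto c xi).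
  have [c lc /andP[e'c cxi]] := cof _ e'xi.
  apply: (direct c) => //; last exact: lto_le_trans e'c.
  case: lc (lc) => [[_ cc]|[lrho _] lc]; last exact: ladder_succ lc.
  by have := cc _ xirho; rewrite leoNgt cxi.
move=> /existsNP[eta'' /not_implyP[e''xi ne'']].
have [c0 [lc0 xic0 c0min]] := next_ex xirho.
(* No ladder point lies between [eta''] and [xi], so for [s] between [mx] and [xi] the first step is
   [c0], where the induction hypothesis applies. *)
have [mx [mxxi emx e''mx]] : exists mx, [/\ lto mx xi, leo eta mx & leo eta'' mx].
  by case/orP: (leo_total eta eta'') => ?; [exists eta''|exists eta]; split=> //; exact: leo_refl.
have [s [rs mxs sxi sw]] := IH c0 (ladder_lt lc0) mx xic0 mxxi.
exists s; split=> //; first exact: leo_lto_trans mxs.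
move=> al /walk_inv[->|[c [srho [lc sc cmin] wc]]].
  by rewrite ltoNge (ltoW xirho).
suff cc0 : c = c0 by rewrite cc0 in wc; exact: sw.
apply: leo_anti; first by apply: cmin => //; exact: leo_trans (ltoW sxi) xic0.
apply: c0min => //; rewrite leoNgt; apply/negP => cxi; apply: ne''; exists c => //.
by rewrite cxi andbT; exact: leo_trans e''mx (leo_trans (ltoW mxs) sc).
Qed.

End Walks.

(** * Sufficiency *)

Lemma ord_lt_succ (a : ordtype) : ord_lt a (ord_succ a).
Proof.
apply/ord_ltP; exists None, (fun x y => y = Some x); split.
- by move=> x _; exists (Some x).
- by move=> [x|//] _; exists x.
- by move=> x x' _ _ _ _ _ _ -> ->.
Qed.

Lemma oseg_ltP (a : ordtype) (x y : a) : lto x y -> ord_lt (oseg x) (oseg y).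
Proof.
move=> xy; pose x' : oseg y := exist (fun z => z \in [pred z | lto z y]) x xy.
apply/ord_ltP; exists x', (fun u v => sval u = sval v); split.
- move=> [u ux] _; exists (exist (fun z => z \in [pred z | lto z y]) u (lto_trans (ux : lto u x) xy)) => //.
- by move=> [v vy] vx; exists (exist (fun z => z \in [pred z | lto z x]) v vx).
- by move=> u u' v v' _ _ _ _ /= uv u'v'; rewrite /leo /= uv u'v'.
Qed.

Lemma oseg_lt_lto (a : ordtype) (x y : a) : ord_lt (oseg x) (oseg y) -> lto x y.
Proof.
move=> xy; case: (ltoP x y) => // [exy|/oseg_ltP yx].
  by case: (@ord_lt_irr (oseg x)); rewrite {2}exy.
by case: (ord_lt_not_le xy); left.
Qed.

(** * Heights realised in one fixed ordinal *)

Section Rank.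
Context {d : Order.disp_t} {T : treeType d} {W : ordtype} {rk : T -> W}.
Hypothesis rkP : forall t : T, ord_iso (ht t) (oseg (rk t)).
Implicit Types s t x y : T.

Lemma rk_lt s t : (s < t)%O -> lto (rk s) (rk t).
Proof.
move=> st; apply: oseg_lt_lto.
apply: ord_lt_le_trans (or_intror (rkP t)).
by case: (ht_lt st) => x sx; exists x; exact: ord_iso_trans (ord_iso_sym (rkP s)) sx.
Qed.

Lemma rk_ht s t : rk s = rk t -> ord_iso (ht s) (ht t).
Proof. by move=> e; apply: ord_iso_trans (rkP s) _; rewrite e; exact: ord_iso_sym. Qed.

Lemma rk_inj t s s' : (s <= t)%O -> (s' <= t)%O -> rk s = rk s' -> s = s'.
Proof. by move=> st s't ss'; apply: (ht_inj st s't); exact: rk_ht. Qed.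

Lemma rk_lt_inv t s s' : (s <= t)%O -> (s' <= t)%O -> lto (rk s) (rk s') -> (s < s')%O.
Proof.
move=> st s't ss'; apply: (tree_ltNge s't st); rewrite le_eqVlt negb_or.
apply/andP; split; first by apply: contraTneq ss' => ->; rewrite lto_irr.
by apply/negP => /rk_lt /(lto_trans ss'); rewrite lto_irr.
Qed.

Lemma rk_down t (al : W) : lto al (rk t) -> exists2 s, (s < t)%O & rk s = al.
Proof.
move=> /oseg_ltP /ord_lt_le_trans /(_ (or_intror (ord_iso_sym (rkP t)))) [x xal].
exists (sval x); first exact: seg_lt.
apply: oseg_inj; apply: ord_iso_trans (ord_iso_sym (rkP _)) _.
apply: ord_iso_trans (ord_iso_sym xal).
by case: x xal => x xt _; exact: (ht_seg (xt : (x < t)%O)).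
Qed.

Lemma obig_rk t : obig (rk t) -> big t.
Proof.
move=> [[al alt] bt]; split=> [|y yt]; first by have [s st _] := rk_down alt; exists s.
have [n|z zt yz] := bt (fun n => rk (y n)); first exact: rk_lt.
have [s st rks] := rk_down zt; exists s => // n.
by apply: (@rk_lt_inv t); rewrite ?ltW// rks.
Qed.

Lemma olimit_rk t : limit t <-> olimit (rk t).
Proof.
split=> [[[y yt] lt]|[[al alt] lt]].
  split; first by exists (rk y); exact: rk_lt.
  by move=> al /rk_down[s /lt[z sz zt] <-]; exists (rk z); exact: rk_lt.
split=> [|y yt]; first by have [s st _] := rk_down alt; exists s.
have [z yz zt] := lt _ (rk_lt yt); have [s st rks] := rk_down zt; exists s => //.
by apply: (@rk_lt_inv t); rewrite ?ltW// rks.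
Qed.

End Rank.

(* Distinct points of one class of the discrete decomposition have disjoint
   intervals; the interval of [t] is then shrunk against the countably many points
   of earlier classes whose cone contains [t]. *)
Lemma disjoint_intervals (d : Order.disp_t) (T : treeType d) (E : set T) (al : ordtype) :
  chain_complete T -> (forall t, E t -> big t /\ ord_iso (ht t) al) ->
  omega1_relatively_discrete (E : set (coarse_wedge T)) ->
  exists g : T -> T, (forall t, E t -> (g t < t)%O) /\
    forall t t' s, E t -> E t' -> (g t <= s)%O -> (s < t)%O ->
      (g t' <= s)%O -> (s < t')%O -> t = t'.
Proof.
move=> chainT EP [D Ddisc ED].
have Elt t t' : E t -> E t' -> (t < t')%O -> False.
  move=> /EP[_ ht_t] /EP[_ ht_t'] /ht_lt /ord_lt_not_le; apply; right.
  exact: ord_iso_trans ht_t' (ord_iso_sym ht_t).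
have /choice[i iP] t : exists i, E t -> D i t.
  have [Et|nEt] := pselect (E t); last by have [i] := omega1_inhabited; exists i.
  by have := Et; rewrite ED => -[i _ Dt]; exists i.
have /choice[g0 g0P] t : exists g, E t ->
    (g < t)%O /\ forall t', D (i t) t' -> (g <= t')%O -> t' = t.
  have [Et|nEt] := pselect (E t); last by exists t.
  have Dt := iP _ Et; pose tD : set_type (D (i t)) := SigSub (mem_set Dt).
  have [U oU Ut] := Ddisc (i t) [set tD].
  have nU : nbhs (t : coarse_wedge T) U.
    apply: open_nbhs_nbhs; split=> //.
    by have : [set tD] tD by []; rewrite -Ut.
  have [bt _] := EP _ Et.
  have [y yt [F [_ sF] FU]] := nbhs_limit chainT (big_limit bt) nU.
  exists y => _; split=> // t' Dt' yt'.
  have Ut' : U t'.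
    apply: FU => // s /sF[ts _]; apply/negP => st'.
    apply: (@Elt t t') => //; last exact: lt_le_trans st'.
    by rewrite ED; exists (i t).
  have : [set tD] (SigSub (mem_set Dt') : set_type (D (i t))) by rewrite -Ut.
  by move=> /(congr1 (fun u : set_type (D (i t)) => \val u)).
have /choice[g gP] t : exists g, E t -> [/\ (g < t)%O, (g0 t <= g)%O &
    forall t', E t' -> lto (i t') (i t) -> (g0 t' <= t)%O -> ~~ (g <= t')%O].
  have [Et|nEt] := pselect (E t); last by exists t.
  have [bt _] := EP _ Et; have [g0t _] := g0P _ Et.
  (* [i] is injective on [K]: the bounds [g0] of two points of [K] are comparable below [t], so one
     of the points isolates itself from the other only if they coincide. *)
  pose K := [set t' | [/\ E t', lto (i t') (i t) & (g0 t' <= t)%O]].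
  have cK : countable K.
    apply: (countable_inj (f := i)) (omega1_seg_countable (i t)) => [t' []//|].
    move=> u v [Eu iu gu] [Ev iv gv] iuv.
    case/orP: (tree_total gu gv) => guv.
      have [_ /(_ v) H] := g0P _ Eu; apply/esym/H; first by rewrite iuv; exact: iP.
      by apply: le_trans guv (ltW _); case: (g0P _ Ev).
    have [_ /(_ u) H] := g0P _ Ev; apply: H; first by rewrite -iuv; exact: iP.
    by apply: le_trans guv (ltW _); case: (g0P _ Eu).
  (* Points of [E] are pairwise incomparable, so some [f t' < t] is not below [t']; countably many
     of these are bounded below [t]. *)
  have /choice[f fP] t' : exists f, K t' -> (f < t)%O /\ ~~ (f <= t')%O.
    have [[Et' it' _]|nK] := pselect (K t'); last by exists t.
    have [|y yt yt'] := @limit_split _ _ chainT t t' (big_limit bt); last by exists y.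
    rewrite le_eqVlt negb_or; apply/andP; split; last by apply/negP => /Elt; apply.
    by apply/eqP => tt'; rewrite tt' lto_irr in it'.
  have [|z zt fz] := big_countable (f := f) bt cK; first by move=> u /fP[].
  have [w [zw gw] wt] : exists2 w, (z <= w)%O /\ (g0 t <= w)%O & (w < t)%O.
    by case/orP: (tree_total (ltW zt) (ltW g0t)) => ?; [exists (g0 t)|exists z].
  exists w => _; split=> // t' Et' it' gt'.
  have Kt' : K t' by split.
  have [_ nft'] := fP _ Kt'; apply: contra nft' => wt'.
  exact: le_trans (ltW (fz _ Kt')) (le_trans zw wt').
exists g; split=> [t /gP[]//|t t' s Et Et' gs st gs' st'].
have [_ gt gnt] := gP _ Et; have [_ gt' gnt'] := gP _ Et'.
(* In one class [g0] already separates. In different classes the interval of the later point was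
   made to start outside the segment below the earlier one. *)
case: (ltoP (i t) (i t')) => [itt'|itt'|itt'].
- have /negP[] := gnt' _ Et itt' (le_trans (le_trans gt gs) (ltW st')).
  exact: le_trans gs' (ltW st).
- have [_ H] := g0P _ Et; apply/esym/H; first by rewrite itt'; exact: iP.
  exact: le_trans (le_trans gt gs) (ltW st').
- have /negP[] := gnt _ Et' itt' (le_trans (le_trans gt' gs') (ltW st)).
  exact: le_trans gs (ltW st').
Qed.

(** * Compactness *)

(** The nodes whose wedges belong to an ultrafilter form a chain, since two such wedges meet. The
    ultrafilter converges to the supremum of this chain. *)
Lemma coarse_wedge_compact (d : Order.disp_t) (T : treeType d) :
  rooted T -> chain_complete T -> compact [set: coarse_wedge T].
Proof.
move=> [r [rmin runiq]] chainT; rewrite compact_ultra => F FU _.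
pose C := [set s : T | node s /\ F (wedge s)].
have FP : ProperFilter F by exact: ultra_proper.
have [|x [xub xlub]] := chainT C.
  move=> u v [_ Fu] [_ Fv]; have [w [uw vw]] := filter_ex (filterI Fu Fv).
  by apply/orP; exact: tree_total uw vw.
exists x; split=> //; apply: nbhs_subbase => s ns sx.
  have [[c [Cc sc]]|nc] := pselect (exists c, C c /\ (s <= c)%O).
    by case: Cc => _; apply: filterS => u cu; exact: le_trans sc cu.
  (* A minimal [s] is the root and its wedge is everything. If [s] covers [t], the whole chain lies
     below [t], and so does [x], contradicting [s <= x]. *)
  case: ns => [smin|[t [ts cts]]].
    have sr : s = r.
      apply/esym/runiq => u us; move: us; rewrite le_eqVlt => /predU1P[->//|].
      by rewrite (negbTE (smin u)).
    apply: (@filterS _ _ _ setT) (filterT) => u _.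
    have [|m [mu _] mmin] := @tree_min _ _ u (fun=> True); first by exists u.
    suff <- : m = s by [].
    by rewrite sr; apply/esym/runiq => v vm; apply: mmin => //; exact: le_trans vm mu.
  suff /(le_trans sx) : (x <= t)%O by rewrite (lt_geF ts).
  apply: xlub => c Cc; apply: cts.
  apply: (tree_ltNge sx (xub _ Cc)); apply/negP => sc; apply: nc; by exists c.
have [Fs|//] := in_ultra_setVsetC (wedge s) FU.
by move/negP: sx; case; exact: xub.
Qed.

(** Closed sets have compact, hence closed, images in the Hausdorff product. *)
Lemma compact_homeo_injection (R : realType) (K : topologicalType) (Gamma : Type)
    (h : K -> {ptws Gamma -> R}) :
  compact [set: K] -> injective h -> (forall g, continuous (fun x => h x g)) ->
  homeo_injection h.
Proof.
move=> cK hinj hc.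
have hcont : continuous h.
  move=> x; apply/cvg_sup => g U [B [[C oC <-] Cx] BU].
  have /(hc g x) : nbhs (h x g) C by apply: open_nbhs_nbhs.
  move=> nC; apply: (@filterS _ _ _ ((fun z => h z g) @^-1` C)) nC => z Cz; exact: (BU (h z) Cz).
split=> // U oU; exists (~` (h @` (~` U))).
  apply: closed_openC; apply: compact_closed.
    by apply: (@hausdorff_product {classic Gamma} (fun=> R)) => _; exact: (@norm_hausdorff R R^o).
  apply: continuous_compact; first exact: continuous_subspaceT.
  exact: (subclosed_compact (open_closedC oU) cK).
apply/seteqP; split=> [_ [x Ux <-]|_ [[x _ <-] nU]].
  by split; [exists x|move=> [y nUy /hinj yx]; apply: nUy; rewrite yx].
by exists x => //; apply: contrapT => nUx; apply: nU; exists x.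
Qed.

Lemma small_option (X : Type) : small X -> small (option X).
Proof.
move=> [f finj]; have [i] := omega1_inhabited.
have [k kinj] : small (nat * omega 1) by apply: small_prod; [exact: small_nat|exists id].
exists (fun o => k (if o is Some x then (1, f x) else (0, i))).
by move=> [x|] [y|] // /kinj[] // /finj ->.
Qed.

Lemma tree_ht_lt (d : Order.disp_t) (T : treeType d) (t : T) : ord_lt (ht t) (tree_ht T).
Proof.
have [ht0 _] := tree_htP T.
case: (ord_trichotomy (ht t) (tree_ht T)) => // [ti|[x ix]].
  by suff : (set0 : set T) t by []; rewrite -ht0.
suff : (set0 : set T) (sval x) by []; rewrite -ht0.
apply: ord_iso_trans (ord_iso_sym ix).
by case: x {ix} => x xt; exact: (ht_seg (xt : (x < t)%O)).
Qed.

(** * Pruned wedges and the embedding *)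

Section Embedding.
Context {R : realType} {d : Order.disp_t} {T : treeType d} {W : ordtype} {rk : T -> W}.
Hypothesis chainT : chain_complete T.
Hypothesis rkP : forall t : T, ord_iso (ht t) (oseg (rk t)).
Variables (e : W -> omega 1) (top : W) (g : T -> T).
Hypothesis einj : injective e.
Hypothesis rk_top : forall t : T, leo (rk t) top.
Hypothesis smallT : forall t : T, small (ht t).
Hypothesis g_lt : forall t, Rset T t -> (g t < t)%O.
Hypothesis g_disj : forall t t' s, Rset T t -> Rset T t' -> rk t = rk t' ->
  (g t <= s)%O -> (s < t)%O -> (g t' <= s)%O -> (s < t')%O -> t = t'.
Hypothesis ims_fin : forall t, Rset T t -> finite_set (ims t).
Implicit Types s t x y : T.

Definition caps s : set T :=
  [set t | [/\ Rset T t, walk e (rk s) top (rk t), (g t <= s)%O & (s < t)%O]].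

Definition pruned s : set (coarse_wedge T) :=
  [set x | (s <= x)%O /\ forall t, caps s t -> ~~ (t < x)%O].

(** The ranks of caps lie on a finite walk, and disjointness of the intervals allows one cap per
    rank. *)
Lemma caps_finite s : finite_set (caps s).
Proof.
have fin : finite_set (rk @` caps s).
  apply: (@sub_finite_set _ _ (walk e (rk s) top)); last exact: walk_finite.
  by move=> _ [t [_ wt _ _] <-].
rewrite -(@eq_finite_set _ _ (rk @` caps s))//; apply: inj_card_eq.
by move=> t t' /set_mem[Rt _ gt st] /set_mem[Rt' _ gt' st'] tt'; exact: (@g_disj t t' s).
Qed.

(** There are finitely many caps, each with finitely many immediate successors, so the removed part
    is a finite union of clopen wedges. *)
Lemma pruned_clopen s : node s -> open (pruned s) /\ closed (pruned s).
Proof.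
move=> ns; pose N : set T := \bigcup_(t in caps s) ims t.
have finN : finite_set N.
  by apply: bigcup_finite; [exact: caps_finite|move=> t [Rt _ _ _]; exact: ims_fin].
have nodeN u : N u -> node u by move=> [t _ /covers_ht tu]; right; exists t.
have -> : pruned s = wedge s `&` ~` \bigcup_(u in N) wedge u.
  apply/seteqP; split=> x [sx xs]; split=> //.
    move=> [u [t ct /covers_ht[tu _]] ux]; move/negP: (xs t ct); apply.
    exact: lt_le_trans ux.
  move=> t ct; apply/negP => tx; apply: xs; have [u tu ux] := covers_ex tx.
  by exists u => //; exists t => //; apply/covers_ht.
split.
  apply: openI; first exact: open_wedge.
  apply: closed_openC; apply: (@closed_bigcup (coarse_wedge T) T) => // u /nodeN.
  exact: closed_wedge.
apply: closedI; first exact: closed_wedge.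
by apply: open_closedC; apply: bigcup_open => u /nodeN; exact: open_wedge.
Qed.

Lemma pruned_self s : pruned s s.
Proof. by split=> // t [_ _ _ st]; rewrite (lt_gtF st). Qed.

Lemma pruned_sep x y : ~~ (x <= y)%O -> exists s, [/\ node s, pruned s x & ~ pruned s y].
Proof.
move=> xy; have [nx|lx] := nodeVlimit x.
  by exists x; split=> //; [exact: pruned_self|by move=> [/(negP xy)]].
have [v vx vy] := limit_split chainT lx xy.
(* The walk to [be] meets no other point below [rk x], so a point [s] of this rank has no cap below
   [x]; as [be] is a successor, [s] is a node. *)
have [be [[r rbe] vbe bex wbe]] := walk_cofinal e ((olimit_rk rkP x).1 lx) (rk_top x) (rk_lt rkP vx).
have [s sx rks] := rk_down rkP bex.
have vs : (v < s)%O by apply: (@rk_lt_inv _ _ _ _ rkP x); rewrite ?ltW// rks.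
exists s; split.
- have [//|/(olimit_rk rkP)] := nodeVlimit s; rewrite rks.
  by move=> /(ocovers_nlimit rbe).
- split=> [|t [Rt wt _ st]]; first exact: ltW.
  apply/negP => /(rk_lt rkP) tx; rewrite rks in wt.
  by have := rk_lt rkP st; rewrite rks (wbe _ wt tx) lto_irr.
- by case=> sy _; move/negP: vy; apply; exact: le_trans (ltW vs) sy.
Qed.

(** Predecessors of [x] are determined by their ranks, and the ranks in question lie in the
    countable set of [walk_countable] for [zeta = rk x]. *)
Lemma pruned_countable x : node x -> countable [set s | node s /\ pruned s x].
Proof.
move=> nx.
have nbx : ~ obig (rk x) by move=> /obig_limit /(olimit_rk rkP) /limit_nnode.
(* [g'] copies [g] to the ranks of the branch below [x]; at ranks without a point of [R] on it, only
   [lto be al] for [obig al] is required. *)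
have /choice[g' g'P] al : exists be, (obig al -> lto be al) /\
    forall t, (t < x)%O -> rk t = al -> Rset T t -> be = rk (g t).
  have [[t [tx rkt Rt]]|nt] := pselect (exists t, [/\ (t < x)%O, rk t = al & Rset T t]).
    exists (rk (g t)); split=> [_|t' t'x rkt' _]; first by rewrite -rkt; exact: rk_lt (g_lt Rt).
    by congr (rk (g _)); apply: (@rk_inj _ _ _ _ rkP x); rewrite ?ltW// rkt.
  have [bal|nbal] := pselect (obig al).
    by have [[be beal] _] := bal; exists be; split=> // t tx rkt Rt; case: nt; exists t.
  by exists al; split=> // t tx rkt Rt; case: nt; exists t.
have cS := walk_countable einj top (fun al => (g'P al).1) nbx.
set S := [set s | _] in cS.
have c2 : countable ([set rk x] `|` S) := countable_setU (countable1 _) cS.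
apply: countable_inj c2 => [s|s s']; last first.
  by move=> [_ [sx _]] [_ [s'x _]]; exact: rk_inj sx s'x.
move=> [ns [sx xs]]; move: sx; rewrite le_eqVlt => /predU1P[->|sx]; [by left|right].
have rksx := rk_lt rkP sx; split=> // [|al wal alx bal].
  exact: lto_le_trans rksx (rk_top x).
rewrite ltoNge; apply/negP => g's.
(* The point [t] of the branch at rank [al] is in [R], having a successor towards [x]. If its
   interval contained [s], it would be a cap of [s] below [x]. *)
have [t tx rkt] := rk_down rkP alx.
have bt : big t by apply: (obig_rk rkP); rewrite rkt.
have Rt : Rset T t.
  apply: big_Rset => //; have [u tu _] := covers_ex tx.
  by exists u; apply/covers_ht.
have gt : g' al = rk (g t) by apply: (g'P al).2.
suff : caps s t by move=> /xs; rewrite tx.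
split=> //; first by rewrite rkt.
  apply/negPn/negP => ngs.
  have /(rk_lt rkP) : (s < g t)%O.
    by apply: (@tree_ltNge _ _ x) ngs; [exact: ltW (lt_trans (g_lt Rt) tx)|exact: ltW].
  by rewrite ltoNge -gt g's.
have sal : leo (rk s) al := walk_ge wal (rk_top s).
have st : (s <= t)%O.
  apply/negPn/negP => nst; have /(rk_lt rkP) : (t < s)%O.
    by apply: (@tree_ltNge _ _ x) nst; exact: ltW.
  by rewrite rkt ltoNge sal.
move: st; rewrite le_eqVlt => /predU1P[est|//].
by case: (limit_nnode (big_limit bt)); rewrite -est.
Qed.

Definition embedding (x : T) : {ptws T -> R} :=
  fun s => (`[< node s /\ pruned s x >]%:R : R)%R.

Lemma embedding_inj : injective embedding.
Proof.
suff H x y : embedding x = embedding y -> (x <= y)%O.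
  by move=> x y exy; apply: le_anti; rewrite !H.
move=> exy; apply/negPn/negP => /pruned_sep[s [ns xs ys]].
have := congr1 (fun f : {ptws T -> R} => f s) exy; rewrite /embedding.
rewrite (asboolT (conj ns xs)) asboolF; last by case.
by move/eqP; rewrite oner_eq0.
Qed.

Lemma embedding_continuous s : continuous (fun x : coarse_wedge T => embedding x s).
Proof.
move=> x U /nbhs_singleton Ux.
have [ns|nns] := pselect (node s); last first.
  have : nbhs x setT by exact: filterT.
  apply: filterS => z _; move: Ux; rewrite /embedding /=.
  by rewrite !asboolF // => -[].
have [op cp] := pruned_clopen ns.
have [xs|nxs] := pselect (pruned s x).
  have : nbhs x (pruned s) by apply: open_nbhs_nbhs.
  apply: filterS => z zs; move: Ux; rewrite /embedding /=.
  by rewrite !asboolT.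
have : nbhs x (~` pruned s) by apply: open_nbhs_nbhs; split=> //; exact: closed_openC.
apply: filterS => z zs; move: Ux; rewrite /embedding /=.
by rewrite !asboolF // => -[].
Qed.

(** The Sigma-subset contains all nodes by [pruned_countable], and the nodes are dense by
    [limit_meets]. *)
Lemma embedding_valdivia : rooted T -> valdivia R (coarse_wedge T).
Proof.
move=> rootedT; have cT := coarse_wedge_compact rootedT chainT; split=> //.
have csupp x : countable [set s | embedding x s <> 0%R] <-> countable [set s | node s /\ pruned s x].
  suff -> : [set s | embedding x s <> 0%R] = [set s | node s /\ pruned s x] by [].
  apply/seteqP; split=> s; rewrite /embedding /=; case: asboolP => //= _ _.
  by apply/eqP; rewrite oner_eq0.
exists [set x | countable [set s | embedding x s <> 0%R]].
  move=> U [x Ux] oU; have [nx|lx] := nodeVlimit x.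
    by exists x; split=> //; apply/csupp; exact: pruned_countable.
  have nU : nbhs (x : coarse_wedge T) U by apply: open_nbhs_nbhs.
  have [[y yx] _] := lx; have [s [ns Us] _] := limit_meets chainT lx nU yx.
  by exists s; split=> //; apply/csupp; exact: pruned_countable.
exists T, embedding; split.
  by apply: compact_homeo_injection => //; [exact: embedding_inj|exact: embedding_continuous].
apply/seteqP; split=> [_ [x cx <-]|_ [[x _ <-] cx]]; last by exists x.
by split=> //; exists x.
Qed.

End Embedding.

Lemma valdivia_sufficient (R : realType) (d : Order.disp_t) (T : treeType d) :
  rooted T -> chain_complete T -> ord_lt (tree_ht T) (omega 2) ->
  (forall t : T, Rset T t -> finite_set (ims t)) ->
  (forall a : ordtype, ord_lt a (omega 2) -> ord_iso (cof a) (omega 1) ->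
     omega1_relatively_discrete (Rset T `&` Lev T a : set (coarse_wedge T))) ->
  valdivia R (coarse_wedge T).
Proof.
move=> rootedT chainT ht2 fin_ims disc.
(* The added top element bounds all ranks and is the common start of the walks. *)
pose W := ord_succ (tree_ht T); pose top : W := None.
have lt2 (t : T) : ord_lt (ht t) (omega 2).
  by apply: ord_lt_le_trans (tree_ht_lt t) _; left.
have /choice[rk rkP] (t : T) : exists x : W, ord_iso (ht t) (oseg x).
  by have [x] := ord_lt_le_trans (tree_ht_lt t) (or_introl (ord_lt_succ (tree_ht T))); exists x.
have rk_top (t : T) : leo (rk t) top by case: (rk t).
have [e einj] : small W by apply: small_option; exact: small_lt_omega2.
have /choice[G GP] (t0 : T) : exists g : T -> T, Rset T t0 ->
    (forall t, Rset T t -> Lev T (ht t0) t -> (g t < t)%O) /\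
    forall t t' s, Rset T t -> Lev T (ht t0) t -> Rset T t' -> Lev T (ht t0) t' ->
      (g t <= s)%O -> (s < t)%O -> (g t' <= s)%O -> (s < t')%O -> t = t'.
  have [R0|nR0] := pselect (Rset T t0); last by exists id.
  have cof0 : ord_iso (cof (ht t0)) (omega 1).
    case: R0 => + _; rewrite /cf; case: pselect => /= _; last by [].
    move=> /ord_iso_sym[f _ _].
    by have [i] := omega1_inhabited; case: (f i).
  have big0 t : (Rset T `&` Lev T (ht t0)) t -> big t /\ ord_iso (ht t) (ht t0).
    by move=> [Rt Lt]; split=> //; exact: Rset_big.
  have [g [gt gd]] := disjoint_intervals chainT big0 (disc _ (lt2 t0) cof0).
  exists g => _; split=> [t Rt Lt|t t' s Rt Lt Rt' Lt']; first exact: gt.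
  exact: gd.
(* One representative per rank makes all points of [R] of equal rank use the same family of
   intervals. *)
have /choice[rep repP] (al : W) : exists t0 : T, forall t, Rset T t -> rk t = al ->
    Rset T t0 /\ rk t0 = al.
  have [[t0 [R0 rk0]]|nt] := pselect (exists t, Rset T t /\ rk t = al); first by exists t0.
  have [r _] := rootedT; exists r => t Rt rkt; case: nt; by exists t.
pose g t := G (rep (rk t)) t.
have rep_Lev t t' : Rset T t -> rk t' = rk t -> Rset T (rep (rk t)) /\ Lev T (ht (rep (rk t))) t'.
  move=> Rt tt'; have [Rr rkr] := repP _ _ Rt erefl; split=> //.
  by apply: (rk_ht rkP); rewrite rkr.
apply: (embedding_valdivia chainT rkP (g := g) einj rk_top) => //.
- by move=> t; exact: small_lt_omega2.
- by move=> t Rt; have [Rr Lt] := rep_Lev t t Rt erefl; have [gt _] := GP _ Rr; exact: gt.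
- move=> t t' s Rt Rt' tt'; rewrite /g -tt'.
  have [Rr Lt] := rep_Lev t t Rt erefl; have [_ Lt'] := rep_Lev t t' Rt (esym tt').
  by have [_ gd] := GP _ Rr; exact: gd.
Qed.

Theorem theorem3p2 (R : realType) (d : Order.disp_t) (T : treeType d)
    (rootedT : rooted T) (chainT : chain_complete T) :
  let cond_i :=
    forall t : T, Rset T t -> finite_set (ims t) in
  let cond_ii :=
    forall a : ordtype, ord_lt a (omega 2) -> ord_iso (cof a) (omega 1) ->
      omega1_relatively_discrete (Rset T `&` Lev T a : set (coarse_wedge T)) in
  (valdivia R (coarse_wedge T) ->
     ord_le (tree_ht T) (omega 2) /\ cond_i /\ cond_ii) /\
  (ord_lt (tree_ht T) (omega 2) -> cond_i -> cond_ii ->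
     valdivia R (coarse_wedge T)).
Proof.
move=> cond_i cond_ii; split=> [|ht2 ci cii]; last exact: valdivia_sufficient.
move=> /(valdivia_necessary chainT)[lev2 ci cii].
by split; [apply: (tree_htP T).2|split=> // a a2 _; exact: cii].
Qed.
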